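(* Let $1\le p<\infty$ and let $D_\varepsilon$ be connected for $\varepsilon\in[0,\varepsilon_0]$. Then there exists a constant $C_P$ independent of $\varepsilon$ such that for every $\varepsilon\in(0,\varepsilon_0)$ and every $v\in W^{1,p}(D_\varepsilon;\omega^\varepsilon)$ $$\|v\|^p_{L^p(D_\varepsilon;\omega^\varepsilon)}\le C_P\Bigl(\|\nabla v\|^p_{L^p(D_\varepsilon;\omega^\varepsilon)}+\int_{D_\varepsilon}|v|^p\,|\nabla\omega^\varepsilon|\,dx\Bigr).$$
   Context: $D\subset\mathbb{R}^n$ is a bounded domain (open, connected) with boundary of class $C^{1,1}$. $d_D(x)=\mathrm{dist}(x,D)-\mathrm{dist}(x,\mathbb{R}^n\setminus D)$; $D_t=\{x: d_D(x)<t\}$ (so $D_0=D$); $\Gamma_\varepsilon=D_\varepsilon\setminus\overline{D_{-\varepsilon}}$. The number $\varepsilon_0>0$ is fixed and sufficiently small depending only on $D$ (so that $d_D$ is $C^{1,1}$ and nearest-point projection onto $\partial D$ is single-valued on $\Gamma_{2\varepsilon_0}$). $S:\mathbb{R}\to\mathbb{R}$ is a fixed function satisfying: (S1) $S$ is Lipschitz, $S(t)=t/|t|$ for $|t|\ge1$, $S'(t)>0$ for $|t|<1$, and $S(-t)=-S(t)$; (S2) there are $\zeta_1,\zeta_2,\alpha>0$ with $\zeta_1t^\alpha\le(1+S(t-1))/2\le\zeta_2t^\alpha$ for all $t\in(0,2)$. Put $\omega^\varepsilon(x)=\frac12\bigl(1+S(-d_D(x)/\varepsilon)\bigr)$, so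 $D_\varepsilon=\{\omega^\varepsilon>0\}$. $L^p(D_\varepsilon;\omega^\varepsilon)$ has norm $\|v\|^p_{L^p(D_\varepsilon;\omega^\varepsilon)}=\int_{D_\varepsilon}|v|^p\omega^\varepsilon dx$; $W^{1,p}(D_\varepsilon;\omega^\varepsilon)$ is the space of $v$ with $v$ and its weak first partial derivatives in $L^p(D_\varepsilon;\omega^\varepsilon)$. *)

(* Defs.v *)
From HB Require Import structures.
From mathcomp Require Import all_boot all_order all_algebra.
From mathcomp Require Import all_classical all_reals all_analysis.

Set Implicit Arguments.
Unset Strict Implicit.
Unset Printing Implicit Defensive.

Import Order.TTheory GRing.Theory Num.Theory.
Import numFieldNormedType.Exports.

Local Open Scope classical_set_scope.
Local Open Scope ring_scope.

(** * Lebesgue measure on [R^n] *)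

Definition rV_display : measure_display -> measure_display.
Proof. exact. Qed.

Section measurable_rV.
Context {d} {T : sigmaRingType d}.
Variable n : nat.

Let coors (i : 'I_n) (x : 'rV[T]_n) : T := x 0 i.

Let rV_set0 : g_sigma_preimage coors set0.
Proof. exact: sigma_algebra0. Qed.

Let rV_setC A : g_sigma_preimage coors A -> g_sigma_preimage coors (~` A).
Proof. exact: sigma_algebraC. Qed.

Let rV_bigcup (F : _^nat) : (forall i, g_sigma_preimage coors (F i)) ->
  g_sigma_preimage coors (\bigcup_i (F i)).
Proof. exact: sigma_algebra_bigcup. Qed.

(* The product sigma-algebra; for [T = R] it is the Borel sigma-algebra. *)
HB.instance Definition _ := @isMeasurable.Build (rV_display d)
  'rV[T]_n (g_sigma_preimage coors) rV_set0 rV_setC rV_bigcup.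

End measurable_rV.

Section lebesgue_rV.
Variable R : realType.
Local Notation rcons_mx n :=
  (fun p : R * 'rV[R]_n => row_mx p.1%:M p.2 : 'rV[R]_n.+1).

Lemma measurable_rV_coord n (i : 'I_n) :
  measurable_fun [set: 'rV[R]_n] (fun x => x 0 i).
Proof.
move=> _ Y mY; rewrite setTI; apply: sub_sigma_algebra => /=.
rewrite -bigcup_seq/=; exists i => /=; first by rewrite mem_index_enum.
by exists Y => //; rewrite setTI.
Qed.

Lemma measurable_rVP d (T : measurableType d) n (f : T -> 'rV[R]_n) :
  (forall i, measurable_fun [set: T] (fun t => f t 0 i)) ->
  measurable_fun [set: T] f.
Proof.
move=> mf; have : g_sigma_preimage (fun i t => f t 0 i) `<=` measurable.
  apply: smallest_sub; first exact: sigma_algebra_measurable.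
  case: n => [|n] in f mf *; first by rewrite big_ord0.
  rewrite -bigcup_mkord_ord; apply: bigcup_sub => i Ii.
  by move=> A [B mB <-]; exact: mf.
have := g_sigma_preimage_comp (fun (i : 'I_n) (x : 'rV[R]_n) => x 0 i) f.
move=> -> fS _ A mA; apply: fS; exists A => //.
Qed.

Lemma measurable_rcons_mx n : measurable_fun setT (rcons_mx n).
Proof.
apply: measurable_rVP => i; case: (split_ordP (i : 'I_(1 + n))) => j ->.
  rewrite (_ : (fun _ => _) = fst); first exact: measurable_fst.
  apply/funext => x /=.
  by apply: (etrans (row_mxEl _ _ _ _)); rewrite mxE ord1 eqxx.
rewrite (_ : (fun _ => _) = (fun x : 'rV[R]_n => x 0 j) \o snd); last first.
  by apply/funext => x /=; exact: row_mxEr.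
by apply: measurableT_comp; [exact: measurable_rV_coord|exact: measurable_snd].
Qed.

Section step.
Variables (n : nat) (mu : {sigma_finite_measure set 'rV[R]_n -> \bar R}).

Definition lebesgue_rV_step : set 'rV[R]_n.+1 -> \bar R :=
  pushforward (lebesgue_measure \x mu)%E (rcons_mx n).

Let leb0 : lebesgue_rV_step set0 = 0%E.
Proof. by rewrite /lebesgue_rV_step /pushforward preimage_set0 measure0. Qed.

Let leb_ge0 A : (0 <= lebesgue_rV_step A)%E.
Proof. by rewrite /lebesgue_rV_step /pushforward; exact: measure_ge0. Qed.

Let leb_sigma_additive : semi_sigma_additive lebesgue_rV_step.
Proof.
have mf := @measurable_rcons_mx n.
move=> F mF tF mUF; rewrite /lebesgue_rV_step /pushforward preimage_bigcup.
apply: measure_semi_sigma_additive.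
- by move=> k; rewrite -[X in measurable X]setTI; exact: mf.
- apply/trivIsetP => /= i j _ _ ij; rewrite -preimage_setI.
  by move/trivIsetP : tF => /(_ _ _ _ _ ij) ->//; rewrite preimage_set0.
- by rewrite -preimage_bigcup -[X in measurable X]setTI; exact: mf.
Qed.

HB.instance Definition _ := isMeasure.Build _ _ _ lebesgue_rV_step
  leb0 leb_ge0 leb_sigma_additive.

Let leb_sigma_finite : sigma_finite [set: 'rV[R]_n.+1] lebesgue_rV_step.
Proof.
have /sigma_finiteP[F [TF ndF Foo]] := sigma_finiteT (@lebesgue_measure R).
have /sigma_finiteP[G [TG ndG Goo]] := sigma_finiteT mu.
pose g (x : 'rV[R]_n.+1) : R * 'rV[R]_n :=
  (lsubmx (x : 'rV_(1 + n)) 0 0, rsubmx (x : 'rV_(1 + n))).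
have mg : measurable_fun setT g.
  apply/measurable_fun_pairP; split.
    rewrite (_ : _ \o _ = fun x : 'rV[R]_n.+1 => x 0 (lshift n (0 : 'I_1))).
      exact: measurable_rV_coord.
    by apply/funext => x /=; rewrite mxE.
  apply: measurable_rVP => i.
  rewrite (_ : (fun _ => _) = fun x : 'rV[R]_n.+1 => x 0 (rshift 1 i)).
    exact: measurable_rV_coord.
  by apply/funext => x /=; rewrite mxE.
have gK : cancel (rcons_mx n) g.
  by case=> a b; rewrite /g row_mxKl row_mxKr mxE eqxx.
exists (fun k => g @^-1` (F k `*` G k)).
  apply/esym/seteqP; split => // x _.
  have [i _ Fi] : (\bigcup_k F k) (g x).1 by rewrite -TF.
  have [j _ Gj] : (\bigcup_k G k) (g x).2 by rewrite -TG.
  exists (maxn i j) => //; split => /=.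
    by move: Fi; exact/subsetPset/ndF/leq_maxl.
  by move: Gj; exact/subsetPset/ndG/leq_maxr.
move=> k; have [mF Fkoo] := Foo k; have [mG Gkoo] := Goo k; split.
  by rewrite -[X in measurable X]setTI; apply: mg => //; exact: measurableX.
rewrite /lebesgue_rV_step /pushforward -comp_preimage.
rewrite (_ : g \o _ = id) ?preimage_id; last exact/funext.
by rewrite product_measure1E// lte_mul_pinfty// ge0_fin_numE.
Qed.

HB.instance Definition _ := Measure_isSigmaFinite.Build _ _ _
  lebesgue_rV_step leb_sigma_finite.

End step.

(* [lebesgue_rV 0] is the unit mass on the one-point space ['rV_0]; then
   [lebesgue_rV n.+1] is the product of the one-dimensional Lebesgue measure
   and [lebesgue_rV n], read through [R * 'rV_n ~ 'rV_n.+1]. *)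
Fixpoint lebesgue_rV n : {sigma_finite_measure set 'rV[R]_n -> \bar R} :=
  match n with
  | 0 => dirac (0 : 'rV[R]_0)
  | n'.+1 => lebesgue_rV_step (lebesgue_rV n')
  end.

Lemma lebesgue_rV_box n (A : 'I_n -> set R) :
  (forall i, measurable (A i)) ->
  lebesgue_rV n [set x | forall i, A i (x 0 i)] =
  (\prod_(i < n) lebesgue_measure (A i))%E.
Proof.
elim: n A => [|n IHn] A mA.
  by rewrite big_ord0/= diracE mem_set//; case.
have mB : measurable [set x : 'rV[R]_n | forall i, A (lift ord0 i) (x 0 i)].
  rewrite (_ : mkset _ = \bigcap_(i in [set: 'I_n])
      ((fun x : 'rV[R]_n => x 0 i) @^-1` A (lift ord0 i))); last first.
    by apply/seteqP; split => x Ax i; [move=> _|]; exact: Ax.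
  apply: fin_bigcap_measurable => [|i _]; first exact: finite_finset.
  by rewrite -[X in measurable X]setTI; exact: measurable_rV_coord.
rewrite big_ord_recl -(IHn (fun i => A (lift ord0 i)))//.
rewrite /= /lebesgue_rV_step /pushforward -product_measure1E//; last exact: mA.
have E0 (a : R) (x : 'rV[R]_n) : row_mx (a%:M : 'rV_1) x 0 (ord0 : 'I_(1 + n)) = a.
  rewrite (_ : ord0 = lshift n (0 : 'I_1)); last exact/val_inj.
  by rewrite row_mxEl mxE eqxx.
have E1 (a : R) (x : 'rV[R]_n) (i : 'I_n) :
    row_mx (a%:M : 'rV_1) x 0 (lift ord0 i : 'I_(1 + n)) = x 0 i.
  rewrite (_ : lift ord0 i = rshift 1 i); last exact/val_inj.
  by rewrite row_mxEr.
congr (product_measure1 _ _ _); apply/seteqP; split => -[a x] /=.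
  move=> Ax; split=> [|i]; first by have := Ax ord0; rewrite E0.
  by have := Ax (lift ord0 i); rewrite E1.
move=> [Aa Ax] i; case: (unliftP ord0 i) => [j|] ->; last by rewrite E0.
by rewrite E1; exact: Ax.
Qed.

End lebesgue_rV.

Section euclidean.
Variables (R : realType) (n : nat).
Implicit Types (A U D : set 'rV[R]_n) (f : 'rV[R]_n -> R) (x : 'rV[R]_n).

(* The library norm on ['rV[R]_n] is the max norm; it induces the usual
   topology, but distances and lengths of gradients need the Euclidean one. *)
Definition enorm x : R := Num.sqrt (\sum_(i < n) x 0 i ^+ 2).

Definition partial (i : 'I_n) f x : R := 'D_(delta_mx 0 i) f x.

(* Pointwise gradient; for the Lipschitz function [weight S D eps] below it
   exists almost everywhere and represents the weak gradient. *)
Definition gradient f x : 'rV[R]_n := \row_i partial i f x.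

(* [C^{1,1}(A)]; being Lipschitz does not depend on the choice of norms. *)
Definition C11_on A f : Prop :=
  (forall x, A x -> differentiable f x) /\
  [lipschitz gradient f x | x in A].

Definition boundary A : set 'rV[R]_n := closure A `\` A°.

Definition dist x A : R := inf [set enorm (x - y) | y in A].

Definition sdist D x : R := dist x D - dist x (~` D).

Definition sublevel D t : set 'rV[R]_n := [set x | sdist D x < t].

Definition tube D e : set 'rV[R]_n :=
  sublevel D e `\` closure (sublevel D (- e)).

(* [eps0] is small enough for the signed distance to be [C^{1,1}] and the
   nearest-point projection onto the boundary to be single-valued. *)
Definition tubular_radius D (eps0 : R) : Prop :=
  [/\ 0 < eps0,
      C11_on (tube D (2 * eps0)) (sdist D) &
      forall x, tube D (2 * eps0) x ->
        exists! y, boundary D y /\ enorm (x - y) = dist x (boundary D)].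

Definition weight (S : R -> R) D (eps : R) x : R :=
  2^-1 * (1 + S (- sdist D x / eps)).

Fixpoint Ck (k : nat) f : Prop :=
  continuous f /\
  if k is k'.+1 then
    forall i, (forall x, derivable f x (delta_mx 0 i)) /\ Ck k' (partial i f)
  else True.

Definition test_function U (phi : 'rV[R]_n -> R) : Prop :=
  let supp := closure [set x | phi x != 0] in
  [/\ forall k, Ck k phi, compact supp & supp `<=` U].

Definition L1loc U f : Prop :=
  measurable_fun U f /\
  forall K, compact K -> K `<=` U ->
    (\int[lebesgue_rV R n]_(x in K) `|f x|%:E < +oo)%E.

Definition weak_partial U (i : 'I_n) f (g : 'rV[R]_n -> R) : Prop :=
  [/\ L1loc U f, L1loc U g &
      forall phi, test_function U phi ->
        (\int[lebesgue_rV R n]_(x in U) (f x * partial i phi x)%:E =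
         - \int[lebesgue_rV R n]_(x in U) (g x * phi x)%:E)%E].

(* The [p]-th power of the norm of [L^p(U; w)]. *)
Definition Lp_normp U (w : 'rV[R]_n -> R) (p : R) f : \bar R :=
  (\int[lebesgue_rV R n]_(x in U) (`|f x| `^ p * w x)%:E)%E.

Definition in_Lp U (w : 'rV[R]_n -> R) (p : R) f : Prop :=
  measurable_fun U f /\ (Lp_normp U w p f < +oo)%E.

(* [v] is in [W^{1,p}(U; w)] and [G] is its weak gradient (which is determined
   by [v] almost everywhere). *)
Definition sobolev U (w : 'rV[R]_n -> R) (p : R)
    (v : 'rV[R]_n -> R) (G : 'rV[R]_n -> 'rV[R]_n) : Prop :=
  in_Lp U w p v /\
  forall i, weak_partial U i v (fun x => G x 0 i) /\
            in_Lp U w p (fun x => G x 0 i).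

End euclidean.

(* Near each boundary point, after a linear isometry [Q], the set [D] is the
   strict epigraph of a [C^{1,1}] function of all coordinates but the first. *)
Definition C11_boundary (R : realType) (n : nat) (D : set 'rV[R]_n.+1) : Prop :=
  forall z, boundary D z ->
  exists (r : R) (Q : 'M[R]_n.+1) (gam : 'rV[R]_n -> R),
    [/\ 0 < r, Q *m Q^T = 1%:M, C11_on setT gam &
        forall x, enorm (x - z) < r ->
          let y := x *m Q in
          D x <-> gam (\row_(j < n) y 0 (lift ord0 j)) < y 0 ord0].

Definition bounded_C11_domain (R : realType) (n : nat)
    (D : set 'rV[R]_n.+1) : Prop :=
  [/\ D !=set0, open D, connected D, bounded_set D & C11_boundary D].

Definition transition_profile (R : realType) (S : R -> R) : Prop :=
  [/\ lipschitz S,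
      forall t, 1 <= `|t| -> S t = t / `|t|,
      forall t, `|t| < 1 -> derivable S t 1 /\ 0 < derive1 S t,
      forall t, S (- t) = - S t &
      exists zeta1 zeta2 alpha : R,
        [/\ 0 < zeta1, 0 < zeta2, 0 < alpha &
            forall t, 0 < t < 2 ->
              zeta1 * t `^ alpha <= (1 + S (t - 1)) / 2 <= zeta2 * t `^ alpha]].

(* Main.v *)
From HB Require Import structures.
Require Import Defs.
From mathcomp Require Import all_boot all_order all_algebra.
From mathcomp Require Import all_classical all_reals all_analysis.
From mathcomp Require Import measurable_realfun.
From mathcomp Require Import ring lra.

Set Implicit Arguments.
Unset Strict Implicit.
Unset Printing Implicit Defensive.

Import Order.TTheory GRing.Theory Num.Theory.
Import numFieldNormedType.Exports.

Local Open Scope classical_set_scope.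
Local Open Scope ring_scope.

(** The inequality is a Friedrichs inequality whose boundary term is spread
over the layer where the weight [w] varies.  Write [x1] for the first
coordinate and choose [M] with [0 <= x1 + M <= 2 M] on [D_eps].  As [w] vanishes
on the boundary of [D_eps], integrating [1 = d_1 (x1 + M)] by parts gives
formally
  int |v|^p w = - int (x1 + M) d_1 (|v|^p w)
             <= 2 M p int |v|^(p-1) |d_1 v| w + 2 M int |v|^p |d_1 w|,
and half of the left-hand side absorbs the first term on the right by Young's
inequality.  The constant depends only on [p] and on a box that contains every
[D_eps], hence not on [eps].

Two devices make this rigorous.

First, [w] is replaced by the truncation [f = trunc del w].  It has compact
support in [D_eps], and it is locally constant near the points where [w] may
fail to be differentiable: at distance [eps] from the boundary of [D], where the
profile [S] has a corner, [w] is 0 or 1.  Letting [del] tend to 0 recovers [w]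
by dominated convergence.

Second, no chain rule for [|v|^p] is used.  The integration by parts is carried
out with difference quotients in the direction [e1].  The weak derivative [g] of
[v] satisfies
  v (x + h e1) - v x = int_0^h g (x + s e1) ds   for almost every x
([ae_difference]).  To see this, test the weak derivative against a product of
one-variable bumps slid along [e1]; as the bumps tend to the indicator of a box,
both sides of the identity get the same integral over every small box.  By
convexity and Young's inequality, [|v x|^p] exceeds [|v (x + h e1)|^p] by at most
[h] times the sum of a small multiple of [|v x|^p] and a multiple of the average
of [|g|^p] over the segment ([increment_bound_exists]).
Multiplying by [(x1 + M) f], integrating, and moving the shift from [v] to
[(x1 + M) f] by translation invariance gives the inequality at step [h]
([step_inequality]); then [h] tends to 0 ([limit_inequality]).  What remains is
to check the hypotheses of that lemma for the truncated weight
([truncated_inequality]). *)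

(** * Boxes and Lebesgue measure on row vectors *)

Section boxes.
Variables (R : realType) (n : nat).
Implicit Types (a b : 'I_n -> R) (x : 'rV[R]_n).

Definition obox a b : set 'rV[R]_n := [set x | forall i, a i < x 0 i < b i].

Definition oboxes : set (set 'rV[R]_n) := [set A | exists a b, A = obox a b].

Lemma oboxI a b a' b' : obox a b `&` obox a' b' =
  obox (fun i => Num.max (a i) (a' i)) (fun i => Num.min (b i) (b' i)).
Proof.
apply/seteqP; split => x /=.
  move=> [h h'] i; move: (h i) (h' i) => /andP[h1 h2] /andP[h3 h4].
  by rewrite gt_max lt_min h1 h2 h3 h4.
by move=> h; split => i; have := h i; rewrite gt_max lt_min
  => /andP[/andP[h1 h2] /andP[h3 h4]]; rewrite ?h1 ?h2 ?h3 ?h4.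
Qed.

Lemma setI_closed_oboxes : setI_closed oboxes.
Proof. by move=> _ _ [a [b ->]] [a' [b' ->]]; rewrite oboxI; do 2 eexists. Qed.

Lemma measurable_obox a b : measurable (obox a b).
Proof.
rewrite (_ : obox a b = \bigcap_(i in [set: 'I_n])
    ((fun x : 'rV[R]_n => x 0 i) @^-1` `]a i, b i[)); last first.
  apply/seteqP; split => x.
    by move=> h i _; rewrite /= in_itv/=; exact: h.
  by move=> h i; have := h i Logic.I; rewrite /= in_itv.
apply: fin_bigcap_measurable => [|i _]; first exact: finite_finset.
by rewrite -[X in measurable X]setTI; exact: measurable_rV_coord.
Qed.

Lemma bigcup_obox : \bigcup_k obox (fun=> - k%:R) (fun=> k%:R) = [set: 'rV[R]_n].
Proof.
apply/seteqP; split => // x _.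
pose M := \big[Num.max/0]_i `|x 0 i|.
exists (Num.truncn M).+1 => // i /=.
rewrite -ltr_norml; apply: le_lt_trans (truncnS_gt _).
exact: le_bigmax.
Qed.

(** Boxes form a pi-system, so this makes them a uniqueness class for measures. It
    suffices to reach the half-spaces [c < x_i], which are countable unions of boxes. *)
Lemma measurable_oboxes : @measurable _ 'rV[R]_n = <<s oboxes >>.
Proof.
apply/seteqP; split; last first.
  apply: smallest_sub; first exact: sigma_algebra_measurable.
  by move=> _ [a [b ->]]; exact: measurable_obox.
apply: smallest_sub; first exact: smallest_sigma_algebra.
have key (i : 'I_n) : measurable_fun [set: g_sigma_algebraType oboxes]
    (fun x => (x : 'rV[R]_n) 0 i).
  apply: (measurability (@RGenOInfty.G R)).
    exact: RGenOInfty.measurableE.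
  move=> _ [_ [c ->] <-]; rewrite setTI.
  rewrite (_ : _ @^-1` _ = \bigcup_k
    obox (fun j => if j == i then c else - k%:R) (fun=> k%:R)).
    apply: bigcupT_measurable => k.
    by apply: sub_sigma_algebra; do 2 eexists.
  apply/seteqP; split => x /=; rewrite in_itv/= andbT.
    move=> cx; have [k _ xk] : (\bigcup_k obox (fun=> - k%:R) (fun=> k%:R)) x.
      by rewrite bigcup_obox.
    exists k => // j; case: eqP => [->|_]; last exact: xk.
    by rewrite cx; have /andP[] := xk i.
  by move=> [k _] /(_ i); rewrite eqxx => /andP[].
by move=> A; rewrite -bigcup_seq => -[i _ [B mB <-]]; exact: key.
Qed.

Lemma eq_measure_obox (m1 m2 : {measure set 'rV[R]_n -> \bar R}) :
  (forall a b, m1 (obox a b) = m2 (obox a b)) ->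
  (forall a b, (m1 (obox a b) < +oo)%E) ->
  forall A, measurable A -> m1 A = m2 A.
Proof.
move=> m12 m1oo A mA.
apply: (measure_unique oboxes (fun k => obox (fun=> - k%:R) (fun=> k%:R))) => //.
- exact: measurable_oboxes.
- exact: setI_closed_oboxes.
- by move=> k; do 2 eexists.
- exact: bigcup_obox.
- by move=> _ [a [b ->]].
Qed.

Lemma lebesgue_obox a b : lebesgue_rV R n (obox a b) =
  (\prod_(i < n) lebesgue_measure `]a i, b i[%classic)%E.
Proof. by rewrite -lebesgue_rV_box. Qed.

Lemma lebesgue_obox_lty a b : (lebesgue_rV R n (obox a b) < +oo)%E.
Proof.
rewrite lebesgue_obox -ge0_fin_numE; last exact: prode_ge0.
apply: prode_fin_num => i _.
by rewrite lebesgue_measure_itv/=; case: ifPn.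
Qed.

Lemma measurable_shift (c : 'rV[R]_n) :
  measurable_fun [set: 'rV[R]_n] (fun x => x + c).
Proof.
apply: measurable_rVP => i.
rewrite (_ : (fun _ => _) = (fun x : 'rV[R]_n => x 0 i + c 0 i)); last first.
  by apply/funext => x; rewrite mxE.
apply: measurable_funD => //; exact: measurable_rV_coord.
Qed.

(** Translating a box shifts each of its sides, and boxes determine the measure. *)
Lemma lebesgue_rV_shift (c : 'rV[R]_n) A : measurable A ->
  pushforward (lebesgue_rV R n) (fun x => x + c) A = lebesgue_rV R n A.
Proof.
pose T := isMeasurableFun.Build _ _ _ _ _ (measurable_shift c).
pose f : {mfun 'rV[R]_n >-> 'rV[R]_n} := HB.pack (fun x : 'rV[R]_n => x + c) T.
have H a b : pushforward (lebesgue_rV R n) (fun x => x + c) (obox a b) =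
    lebesgue_rV R n (obox a b).
  rewrite /pushforward.
  rewrite (_ : _ @^-1` _ = obox (fun i => a i - c 0 i) (fun i => b i - c 0 i)).
    rewrite !lebesgue_obox; apply: eq_bigr => i _.
    rewrite !lebesgue_measure_itv/= !lte_fin ltrD2r; case: ifPn => // _.
    by rewrite -!EFinB opprD addrACA subrr addr0.
  apply/seteqP; split => x /= h i; have := h i.
    by rewrite mxE ltrBlDr ltrBrDr.
  by rewrite mxE ltrBlDr ltrBrDr.
apply: (@eq_measure_obox (pushforward (lebesgue_rV R n) f) (lebesgue_rV R n)).
  exact: H.
by move=> a b; rewrite [ltLHS]H lebesgue_obox_lty.
Qed.

End boxes.

(** * Grids, open sets and translation of integrals *)

Section countable_union.
Context d (T : measurableType d) (R : realType) (I : countType).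

Lemma bigcup_unpickle (F : I -> set T) :
  \bigcup_i F i = \bigcup_k (if unpickle k is Some i then F i else set0).
Proof.
apply/seteqP; split => x [].
  by move=> i _ Fi; exists (pickle i) => //; rewrite pickleK.
by move=> k _; case: unpickle => // i Fi; exists i.
Qed.

Lemma bigcup_countType_measurable (F : I -> set T) :
  (forall i, measurable (F i)) -> measurable (\bigcup_i F i).
Proof.
move=> mF; rewrite bigcup_unpickle; apply: bigcupT_measurable => k.
by case: unpickle.
Qed.

Lemma bigcup_countType_negligible (mu : {measure set T -> \bar R})
    (F : I -> set T) :
  (forall i, mu.-negligible (F i)) -> mu.-negligible (\bigcup_i F i).
Proof.
move=> mF; rewrite bigcup_unpickle; apply: negligible_bigcup => k.
by case: unpickle => //; exact: negligible_set0.
Qed.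

End countable_union.

Section grid.
Variables (R : realType) (n : nat).
Implicit Types (N : nat) (z : 'rV[int]_n) (x y : 'rV[R]_n).

(** The cubes of side [2 / N.+1] centred at the points of the grid of mesh
    [1 / N.+1]: they overlap, so that countably many open boxes of a prescribed size
    cover the space. *)
Definition gcube N z : set 'rV[R]_n :=
  obox (fun i => ((z 0 i)%:~R - 1) / N.+1%:R) (fun i => ((z 0 i)%:~R + 1) / N.+1%:R).

Lemma gcube_cover N x : exists z, gcube N z x.
Proof.
exists (\row_i Num.floor (x 0 i * N.+1%:R)) => i; rewrite !mxE.
rewrite ltr_pdivrMr// ltr_pdivlMr//.
have := mem_rg1_floor (x 0 i * N.+1%:R); rewrite /range1 /mkset => /andP[h1 h2].
by rewrite h2 andbT ltrBlDr; apply: (le_lt_trans h1); rewrite ltrDl.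
Qed.

Lemma rV_ball_coord x (e : R) : 0 < e ->
  ball x e = [set y | forall i, `|x 0 i - y 0 i| < e].
Proof.
move=> e0; apply/seteqP; split => y /=.
  by move=> [_ h] i; exact: h.
by move=> h; split => // i j; rewrite !ord1; exact: h.
Qed.

(** The sigma-algebra is the product one, so open sets have to be written as
    countable unions of boxes: here of the grid cubes that they contain. *)
Lemma open_rV_measurable (A : set 'rV[R]_n) : open A -> measurable A.
Proof.
move=> oA.
rewrite (_ : A = \bigcup_(p : nat * 'rV[int]_n)
   (if `[< gcube p.1 p.2 `<=` A >] then gcube p.1 p.2 else set0)).
  apply: bigcup_countType_measurable => p; case: ifPn => // _.
  exact: measurable_obox.
apply/seteqP; split => x; last first.
  by move=> [p _]; case: asboolP => // pA; exact: pA.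
move=> Ax; have /nbhs_ballP[e /= e0 xeA] : nbhs x A by exact: open_nbhs_nbhs.
pose N := Num.truncn (2 / e).
have Ne : 2 / N.+1%:R < e.
  rewrite ltr_pdivrMr// mulrC -ltr_pdivrMr//; exact: truncnS_gt.
have [z xz] := gcube_cover N x.
(* The grid is finer than the radius of a ball around x contained in A. *)
suff NzA : gcube N z `<=` A.
  by exists (N, z) => //=; case: asboolP.
move=> y yz.
apply: xeA; rewrite rV_ball_coord// => i /=.
apply: le_lt_trans Ne.
move: (xz i) (yz i); rewrite !mulrDl mulN1r div1r => /andP[h1 h2] /andP[h3 h4].
move: h1 h2 h3 h4; move: (_^-1) ((z 0 i)%:~R * _) => u t *.
by rewrite ler_norml; apply/andP; split; lra.
Qed.

Lemma closed_rV_measurable (A : set 'rV[R]_n) : closed A -> measurable A.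
Proof. by move/closed_openC/open_rV_measurable/measurableC; rewrite setCK. Qed.

Lemma continuous_rV_measurable (f : 'rV[R]_n -> R) : continuous f ->
  measurable_fun setT f.
Proof.
move=> /continuousP cf; apply: (measurability _ (RGenOpens.measurableE R)).
move=> _ [_ [a [b ->] <-]]; rewrite setTI; apply: open_rV_measurable.
exact/cf/interval_open.
Qed.

End grid.

Section shift_integral.
Variables (R : realType) (n : nat) (c : 'rV[R]_n).
Local Notation mu := (lebesgue_rV R n).
Local Open Scope ereal_scope.

Lemma measurable_fun_shift d (T : measurableType d) (f : 'rV[R]_n -> T) :
  measurable_fun setT f -> measurable_fun setT (fun x : 'rV[R]_n => f (x + c)%R).
Proof. by move=> mf; apply: measurableT_comp => //; exact: measurable_shift. Qed.

Lemma ge0_integral_shift (f : 'rV[R]_n -> \bar R) :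
  measurable_fun setT f -> (forall x, 0 <= f x) ->
  \int[mu]_x f (x + c)%R = \int[mu]_x f x.
Proof.
move=> mf f0; have mc := measurable_shift c.
pose T := isMeasurableFun.Build _ _ _ _ _ mc.
pose phi : {mfun 'rV[R]_n >-> 'rV[R]_n} := HB.pack (fun x : 'rV[R]_n => x + c)%R T.
have := @ge0_integral_pushforward _ _ _ _ _ phi mc mu setT f measurableT mf.
rewrite preimage_setT => /(_ (fun x _ => f0 x)) <-.
apply: eq_measure_integral => A mA _; exact: lebesgue_rV_shift.
Qed.

Lemma integrable_shift (f : 'rV[R]_n -> \bar R) :
  mu.-integrable setT f -> mu.-integrable setT (fun x : 'rV[R]_n => f (x + c)%R).
Proof.
move=> /integrableP[mf fi]; apply/integrableP; split.
  exact: measurable_fun_shift.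
rewrite (ge0_integral_shift (f := fun x => `|f x|)) //.
exact: measurableT_comp.
Qed.

Lemma integral_shift (f : 'rV[R]_n -> \bar R) :
  measurable_fun setT f ->
  \int[mu]_x f (x + c)%R = \int[mu]_x f x.
Proof.
move=> mf; rewrite [LHS]integralE [RHS]integralE.
congr (_ - _).
- have := @ge0_integral_shift (f^\+) (measurable_funepos mf) (funepos_ge0 f).
  by move=> <-; apply: eq_integral => x _; rewrite !funeposE.
- have := @ge0_integral_shift (f^\-) (measurable_funeneg mf) (funeneg_ge0 f).
  by move=> <-; apply: eq_integral => x _; rewrite !funenegE.
Qed.

End shift_integral.

Section box_ae.
Variables (R : realType) (n : nat).
Local Notation mu := (lebesgue_rV R n).
Local Open Scope ereal_scope.

(** The two densities define finite measures that agree on boxes, hence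
    everywhere. *)
Lemma obox_ge0_integral_eq (f g : 'rV[R]_n -> \bar R) (B0 : set 'rV[R]_n) :
  measurable B0 ->
  measurable_fun setT f -> measurable_fun setT g ->
  (forall x, 0 <= f x) -> (forall x, 0 <= g x) ->
  \int[mu]_x f x < +oo ->
  (forall a b, \int[mu]_(x in obox a b `&` B0) f x =
               \int[mu]_(x in obox a b `&` B0) g x) ->
  forall A, measurable A -> \int[mu]_(x in A `&` B0) f x = \int[mu]_(x in A `&` B0) g x.
Proof.
move=> mB0 mf mg f0 g0 foo fg A mA.
have E (h : 'rV[R]_n -> \bar R) C : measurable C -> \int[mu]_(x in C `&` B0) h x =
    \int[mu]_(x in C) ((h \_ B0) x).
  by move=> mC; rewrite integral_mkcondr.
have mm (h : 'rV[R]_n -> \bar R) : measurable_fun setT h -> measurable_fun setT (h \_ B0).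
  move=> mh; apply/(measurable_restrictT _ mB0); exact: measurable_funTS.
have p0 (h : 'rV[R]_n -> \bar R) : (forall x, 0 <= h x) -> forall x, 0 <= (h \_ B0) x.
  by move=> h0 x; rewrite patchE; case: ifP.
have pack (h : 'rV[R]_n -> \bar R) (mh : measurable_fun setT h) (h0 : forall x, 0 <= h x) :
    exists m : {measure set 'rV[R]_n -> \bar R},
      forall C, m C = \int[mu]_(x in C) h x.
  pose M := fun C => \int[mu]_(x in C) h x.
  have M0 : M set0 = 0 by rewrite /M integral_set0.
  have Mge0 C : 0 <= M C by apply: integral_ge0.
  have Ms : semi_sigma_additive M by exact: semi_sigma_additive_nng_induced.
  pose X := isMeasure.Build _ _ _ M M0 Mge0 Ms.
  pose MX : {measure set 'rV[R]_n -> \bar R} := HB.pack M X.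
  by exists MX.
have [m1 m1E] := pack _ (mm _ mf) (p0 _ f0).
have [m2 m2E] := pack _ (mm _ mg) (p0 _ g0).
rewrite !E// -m1E -m2E.
apply: eq_measure_obox => //.
- move=> a b; rewrite m1E m2E -!E//; exact: measurable_obox.
- move=> a b; rewrite m1E -E; last exact: measurable_obox.
  apply: le_lt_trans foo; apply: ge0_subset_integral => //.
  by apply: measurableI => //; exact: measurable_obox.
Qed.

(** Moving negative parts across the equality reduces the statement to nonnegative
    densities. The hypothesis speaks of the traces of boxes on one fixed box because
    the weak derivative is only available away from the boundary of the domain. *)
Lemma obox_integral_ae_eq (f g : 'rV[R]_n -> \bar R) a0 b0 :
  mu.-integrable setT f -> mu.-integrable setT g ->
  (forall a b, \int[mu]_(x in obox a b `&` obox a0 b0) f x =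
               \int[mu]_(x in obox a b `&` obox a0 b0) g x) ->
  ae_eq mu (obox a0 b0) f g.
Proof.
set B0 := obox a0 b0 => fi gi fg.
have mB0 : measurable B0 by exact: measurable_obox.
have mf := measurable_int _ fi; have mg := measurable_int _ gi.
have sw h1 h2 C : mu.-integrable setT h1 -> mu.-integrable setT h2 -> measurable C ->
    \int[mu]_(x in C) (h1^\+ x + h2^\- x) =
    \int[mu]_(x in C) h1^\+ x + \int[mu]_(x in C) h2^\- x.
  move=> i1 i2 mC; rewrite ge0_integralD//.
    apply: measurable_funepos; exact: measurable_funTS (measurable_int _ i1).
  apply: measurable_funeneg; exact: measurable_funTS (measurable_int _ i2).
have fin h C : mu.-integrable setT h -> measurable C ->
   \int[mu]_(x in C) h^\+ x \is a fin_num /\ \int[mu]_(x in C) h^\- x \is a fin_num.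
  move=> ih mC; have ihC := integrableS measurableT mC (@subsetT _ _) ih.
  by split; [apply: integrable_pos_fin_num|apply: integrable_neg_fin_num].
have key C : measurable C ->
   (\int[mu]_(x in C) f x = \int[mu]_(x in C) g x) <->
   (\int[mu]_(x in C) (f^\+ x + g^\- x) = \int[mu]_(x in C) (g^\+ x + f^\- x)).
  move=> mC; rewrite !sw// [in X in X <-> _]integralE [in X in _ = X <-> _]integralE.
  have [/fineK <- /fineK <-] := fin f C fi mC.
  have [/fineK <- /fineK <-] := fin g C gi mC.
  rewrite -!EFinD; split => -[] h; congr EFin; lra.
apply: integral_ae_eq => //.
- exact: integrableS fi.
- exact: measurable_funTS.
move=> A AB0 mA; apply/key => //.
rewrite -(setIidl AB0).
apply: obox_ge0_integral_eq => //.
- by apply: emeasurable_funD; [exact: measurable_funepos|exact: measurable_funeneg].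
- by apply: emeasurable_funD; [exact: measurable_funepos|exact: measurable_funeneg].
- by move=> x; rewrite adde_ge0.
- by move=> x; rewrite adde_ge0.
- rewrite sw//; have [h1 _] := fin f _ fi measurableT.
  have [_ h2] := fin g _ gi measurableT.
  rewrite -ge0_fin_numE; first by rewrite fin_numD h1 h2.
  by apply: adde_ge0; apply: integral_ge0.
- move=> a b; apply/key => //; apply: measurableI => //; exact: measurable_obox.
Qed.

End box_ae.

(** * Smooth bumps in one variable *)

Section smooth1.
Variable R : realType.
Implicit Types (f g : R -> R) (k m : nat) (t c : R).

Fixpoint smooth k f : Prop :=
  if k is k'.+1 then (forall t, derivable f t 1) /\ smooth k' (derive1 f)
  else continuous f.

Lemma derivable1_continuous f : (forall t, derivable f t 1) -> continuous f.
Proof.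
by move=> df t; apply/differentiable_continuous/derivable1_diffP.
Qed.

Lemma smooth_continuous k f : smooth k f -> continuous f.
Proof. by case: k => [//|k [df _]]; exact: derivable1_continuous. Qed.

Lemma smoothW k f : smooth k.+1 f -> smooth k f.
Proof.
elim: k f => [|k IH] f [df sf]; first exact: derivable1_continuous.
by split => //; exact: IH.
Qed.

Lemma smooth_cst k c : smooth k (fun=> c).
Proof.
elim: k c => [|k IH] c /=; first exact: cst_continuous.
split; first by move=> t; exact: derivable_cst.
rewrite (_ : (derive1 _) = fun=> 0); first exact: IH.
by apply/funext => t; rewrite derive1_cst.
Qed.

Lemma is_derive1E f t d : is_derive t 1 f d -> (derive1 f) t = d.
Proof. by move=> h; rewrite derive1E derive_val. Qed.

Lemma is_derive_smooth k f g : (forall t, is_derive t 1 f (g t)) ->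
  smooth k g -> smooth k.+1 f.
Proof.
move=> fg sg; split; first by move=> t; have [] := fg t.
by rewrite (_ : (derive1 f) = g)//; apply/funext => t; exact: is_derive1E.
Qed.

Lemma smooth_is_derive k f t : smooth k.+1 f -> is_derive t 1 f ((derive1 f) t).
Proof. by move=> [df _]; rewrite derive1E; exact: derivableP. Qed.

Lemma smoothD k f g : smooth k f -> smooth k g -> smooth k (fun t => f t + g t).
Proof.
elim: k f g => [|k IH] f g sf sg; first by move=> t; apply: cvgD; [exact: sf|exact: sg].
apply: (@is_derive_smooth _ _ (fun t => (derive1 f) t + (derive1 g) t)).
  move=> t; have := smooth_is_derive t sf; have := smooth_is_derive t sg.
  by move=> hg hf; apply: is_deriveD.
by apply: IH; [exact: sf.2|exact: sg.2].
Qed.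

Lemma smoothM k f g : smooth k f -> smooth k g -> smooth k (fun t => f t * g t).
Proof.
elim: k f g => [|k IH] f g sf sg; first by move=> t; apply: cvgM; [exact: sf|exact: sg].
apply: (@is_derive_smooth _ _ (fun t => f t * (derive1 g) t + g t * (derive1 f) t)).
  move=> t; have := smooth_is_derive t sf; have := smooth_is_derive t sg.
  by move=> hg hf; apply: is_deriveM.
apply: smoothD; apply: IH; [exact: smoothW|exact: sg.2|exact: smoothW|exact: sf.2].
Qed.

Lemma smooth_affine k f c t0 : smooth k f -> smooth k (fun t => f (c * t + t0)).
Proof.
elim: k f => [|k IH] f sf.
  move=> t; apply: (@continuous_comp _ _ _ (fun t => c * t + t0) f); last exact: sf.
  by apply: cvgD; [apply: cvgM; [exact: cvg_cst|exact: cvg_id]|exact: cvg_cst].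
apply: (@is_derive_smooth _ _ (fun t => (derive1 f) (c * t + t0) * c)).
  move=> t; apply: (@is_derive1_comp _ f (fun t => c * t + t0)).
    exact: (@smooth_is_derive k).
  have h1 : is_derive t 1 (fun t => c * t) c.
    have := @is_deriveZ _ _ _ id c t 1 1 (is_derive_id t 1).
    by move=> h; apply: (is_derive_eq h); rewrite /GRing.scale/= mulr1.
  have h2 := @is_deriveD _ _ _ (fun t => c * t) (cst t0) t 1 c 0 h1 (is_derive_cst _ _ _).
  by rewrite addr0 in h2.
by apply: smoothM; [apply: IH; exact: sf.2|exact: smooth_cst].
Qed.

(** For [m = 0] this is the classical smooth function that is flat at 0. The
    family over all [m] is closed under differentiation up to linear combinations,
    which turns smoothness into an induction. *)
Definition flat m t : R := if 0 < t then t^-1 ^+ m * expR (- t^-1) else 0.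

Lemma flat_ge0 m t : 0 <= flat m t.
Proof.
rewrite /flat; case: ifPn => // t0.
by rewrite mulr_ge0 ?expR_ge0// exprn_ge0// invr_ge0 ltW.
Qed.

(** Comes from the lower bound [u ^ (m + 2) / (m + 2)! <= exp u] at [u = 1 / t];
    the quadratic decay gives the derivative 0 at the origin. *)
Lemma flat_le m t : flat m t <= (m.+2)`!%:R * t ^+ 2.
Proof.
rewrite /flat; case: ifPn => [t0|_]; last by rewrite mulr_ge0// sqr_ge0.
have ti : 0 <= t^-1 by rewrite invr_ge0 ltW.
have := expR_ge1Dxn m.+1 ti => h.
have {h} : t^-1 ^+ m.+2 / (m.+2)`!%:R <= expR t^-1.
  by apply: le_trans h; rewrite lerDr.
rewrite expRN ler_pdivrMr ?ltr0n ?fact_gt0// => h.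
rewrite ler_pdivrMr ?expR_gt0//.
rewrite [leLHS](_ : _ = t ^+ 2 * t^-1 ^+ m.+2); last first.
  by rewrite -(addn2 m) exprD mulrCA -exprMn divff ?gt_eqF// expr1n mulr1.
apply: le_trans (ler_wpM2l (sqr_ge0 t) h) _.
by rewrite le_eqVlt; apply/orP; left; apply/eqP; ring.
Qed.

Lemma is_derive_flat m t :
  is_derive t 1 (flat m) (flat m.+2 t - m%:R * flat m.+1 t).
Proof.
have [t0|t0|->] := ltgtP t 0.
- have -> : flat m.+2 t - m%:R * flat m.+1 t = 0.
    by rewrite /flat ltNge (ltW t0)/= mulr0 subr0.
  apply: (@near_eq_is_derive _ _ _ (cst 0)).
    near=> u; rewrite /flat ltNge ltW//=; near: u; exact: lt_nbhsl.
- have -> : flat m.+2 t - m%:R * flat m.+1 t =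
      t^-1 ^+ m.+2 * expR (- t^-1) - m%:R * (t^-1 ^+ m.+1 * expR (- t^-1)).
    by rewrite /flat t0.
  apply: (@near_eq_is_derive _ _ _ (fun t => t^-1 ^+ m * expR (- t^-1))).
    near=> u; rewrite /flat ifT//; near: u; exact: lt_nbhsr.
  have hV : is_derive t 1 (fun u : R => u^-1) (- t ^- 2).
    have := @is_deriveV _ id t 1 1; rewrite gt_eqF// => /(_ isT (is_derive_id _ _)).
    by move=> h; apply: (is_derive_eq h); rewrite /GRing.scale/= mulr1.
  have hX : is_derive t 1 (fun u : R => u^-1 ^+ m) (m%:R * t^-1 ^+ m.-1 * (- t ^- 2)).
    by have := @is_deriveX _ _ (fun u : R => u^-1) m t 1 _ hV; rewrite exprfctE.
  have hE : is_derive t 1 (fun u : R => expR (- u^-1)) (expR (- t^-1) * (t ^- 2)).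
    apply: (@is_derive1_comp _ expR (fun u => - u^-1)).
    by have := @is_deriveN _ _ _ _ _ _ _ hV; rewrite opprK.
  apply: (is_derive_eq (@is_deriveM _ _ _ _ _ _ _ _ hX hE)).
  rewrite /GRing.scale/=.
  case: m {hX} => [|m] /=.
    by rewrite !mul0r mulr0 subr0 addr0 -exprVn; ring.
  by rewrite -exprVn !exprS; ring.
- have -> : flat m.+2 0 - m%:R * flat m.+1 0 = 0.
    by rewrite /flat ltxx mulr0 subr0.
  have L : h^-1 *: ((flat m \o shift 0) (h *: (1 : R)) - flat m 0) @[h --> 0^'] --> (0 : R).
    have C0 : 0 < (m.+2)`!%:R :> R by rewrite ltr0n fact_gt0.
    apply/cvgr0Pnorm_lt => e e0; near=> h.
    have h0 : h != 0 by near: h; exact: nbhs_dnbhs_neq.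
    have he : `|h| < e / (m.+2)`!%:R.
      by near: h; apply: dnbhs0_lt; rewrite divr_gt0.
    rewrite /= addr0 {2}/flat ltxx subr0 [_%:A]mulr1 /GRing.scale/= normrM.
    rewrite normfV ltr_pdivrMl ?normr_gt0// ger0_norm ?flat_ge0//.
    apply: le_lt_trans (flat_le _ _) _.
    rewrite -real_normK ?num_real// expr2 mulrCA ltr_pM2l ?normr_gt0//.
    by rewrite -ltr_pdivlMl// mulrC.
  apply: DeriveDef; last exact/cvg_lim.
  by apply/cvg_ex; exists 0.
Unshelve. all: by end_near. Qed.

Lemma smooth_flat k m : smooth k (flat m).
Proof.
elim: k m => [|k IH] m.
  by apply: derivable1_continuous => t; have [] := is_derive_flat m t.
apply: (@is_derive_smooth _ _ (fun t => flat m.+2 t - m%:R * flat m.+1 t)).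
  exact: is_derive_flat.
apply: smoothD; first exact: IH.
rewrite (_ : (fun _ => _) = fun t => (- m%:R) * flat m.+1 t).
  by apply: smoothM; [exact: smooth_cst|exact: IH].
by apply/funext => t; rewrite mulNr.
Qed.

Lemma flat0_le1 t : flat 0 t <= 1.
Proof.
rewrite /flat; case: ifPn => // t0.
by rewrite expr0 mul1r -expR0 ler_expR oppr_le0 invr_ge0 ltW.
Qed.

Lemma flat0_cvg t : flat 0 (N.+1%:R * t) @[N --> \oo] --> ((0 < t)%R%:R : R).
Proof.
have [t0|t0] := ltP 0 t; last first.
  rewrite (_ : (fun _ => _) = fun=> 0); first exact: cvg_cst.
  by apply/funext => N; rewrite /flat ltNge mulr_ge0_le0.
rewrite (_ : (fun _ => _) = fun N => expR (- (t^-1 * harmonic N))); last first.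
  by apply/funext => N; rewrite /flat mulr_gt0// expr0 mul1r /harmonic invfM mulrC.
have -> : true%:R = expR 0 :> R by rewrite expR0.
apply: continuous_cvg; first exact: continuous_expR.
rewrite -[X in _ --> X]oppr0 -(mulr0 t^-1); apply: cvgN.
by apply: cvgM; [exact: cvg_cst|exact: cvg_harmonic].
Qed.

(** As [N] grows, these functions tend to the indicator of the open interval
    [a < t < b], outside which they all vanish. *)
Definition bump N (a b t : R) : R :=
  flat 0 (N.+1%:R * (t - a)) * flat 0 (N.+1%:R * (b - t)).

Lemma bump_ge0 N a b t : 0 <= bump N a b t.
Proof. by rewrite mulr_ge0 ?flat_ge0. Qed.

Lemma bump_le1 N a b t : bump N a b t <= 1.
Proof. by rewrite mulr_ile1 ?flat_ge0 ?flat0_le1. Qed.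

Lemma bump_eq0 N a b t : ~~ (a < t < b) -> bump N a b t = 0.
Proof.
rewrite /bump negb_and -!leNgt => /orP[h|h].
  by rewrite [X in X * _]/flat ltNge mulr_ge0_le0 ?mul0r ?subr_le0.
by rewrite mulrC [X in X * _]/flat ltNge mulr_ge0_le0 ?mul0r ?subr_le0.
Qed.

Lemma bump_cvg a b t :
  bump N a b t @[N --> \oo] --> ((a < t < b)%R%:R : R).
Proof.
rewrite -(subr_gt0 a) -(subr_gt0 t) -mulnb natrM.
by apply: cvgM; exact: flat0_cvg.
Qed.

Lemma smooth_bump k N a b : smooth k (bump N a b).
Proof.
have -> : bump N a b = fun t => flat 0 (N.+1%:R * t + (- (N.+1%:R * a))) *
    flat 0 ((- N.+1%:R) * t + N.+1%:R * b).
  by apply/funext => t; rewrite /bump !mulrBr mulNr [in X in _ * X]addrC.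
by apply: smoothM; apply: smooth_affine; exact: smooth_flat.
Qed.

End smooth1.

(** * Primitives of bumps and tensor products *)

Section primitive.
Variables (R : realType) (psi : R -> R) (a b : R).
Local Notation leb := (@lebesgue_measure R).
Hypothesis cpsi : continuous psi.
Hypothesis psi0 : forall t, ~~ (a < t < b) -> psi t = 0.

Lemma integrable_support : leb.-integrable setT (EFin \o psi).
Proof.
have -> : EFin \o psi = (EFin \o psi) \_ `[a, b].
  apply/funext => t; rewrite patchE; case: ifPn => // /negP tab.
  rewrite /= psi0//; apply/negP => /andP[h1 h2]; apply: tab.
  by rewrite inE/= in_itv/= !ltW.
apply/(integrable_mkcond _ _).1; first exact: measurable_itv.
apply: continuous_compact_integrable; first exact: segment_compact.
exact: continuous_subspaceT.
Qed.

Definition primitive t : R := \int[leb]_(s in `]-oo, t]) psi s.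

Lemma is_derive_primitive t : is_derive t (1 : R) primitive (psi t).
Proof.
have [] := @continuous_FTC1 R psi -oo%O t (t + 1) _ _ _ (cpsi (x := t)).
- by rewrite ltrDl.
- by apply: integrableS integrable_support => //; exact: measurable_itv.
- by rewrite ltNyr.
- by move=> d e; apply: DeriveDef; [exact: d|rewrite -derive1E; exact: e].
Qed.

Lemma primitive_le t : t <= a -> primitive t = 0.
Proof.
move=> ta; transitivity (\int[leb]_(s in `]-oo, t]) cst (0 : R) s).
  apply: eq_Rintegral => s; rewrite inE/= in_itv/= => st; apply: psi0.
  by rewrite ltNge (le_trans st ta).
by rewrite Rintegral_cst ?mul0r//; exact: measurable_itv.
Qed.

(** With [primitive_le], this makes [primitive t - primitive (t - h)] a compactly
    supported function although [primitive] is not. *)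
Lemma primitive_ge t : b <= t -> primitive t = primitive b.
Proof.
move=> bt; rewrite /primitive Rintegral_mkcond [RHS]Rintegral_mkcond.
apply: eq_Rintegral => s _; rewrite !patchE !mem_setE !in_itv/=.
case: ifPn => st; case: ifPn => sb //.
  by apply: psi0; rewrite -(negbK (s < b)) -leNgt (ltW _) ?andbF// ltNge.
by rewrite (le_trans sb bt) in st.
Qed.

Lemma smooth_primitive k : smooth k psi -> smooth k.+1 primitive.
Proof. by apply: is_derive_smooth; exact: is_derive_primitive. Qed.

(** The slid bump [primitive t - primitive (t - h)] is the average of the bump along
    the segment from [t - h] to [t]; this is how the integral of the weak derivative
    along a segment enters. *)
Lemma integral_primitive t h : 0 < h ->
  (\int[leb]_(s in `[0%R, h]) (psi (t - s))%:E = (primitive t - primitive (t - h))%:E)%E.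
Proof.
move=> h0.
have dF s : is_derive s (1 : R) (fun s => - primitive (t - s)) (psi (t - s)).
  have d1 : is_derive s 1 (fun s : R => t - s) (- 1).
    have := @is_deriveD _ _ _ (cst t) (fun s : R => - s) s 1 _ _
      (is_derive_cst _ _ _) (@is_deriveN _ _ _ _ _ _ _ (is_derive_id s 1)).
    by rewrite add0r.
  have d2 := @is_derive1_comp _ primitive (fun s => t - s) s _ _ (is_derive_primitive _) d1.
  have := @is_deriveN _ _ _ _ _ _ _ d2.
  by rewrite mulrN1 opprK.
rewrite (@continuous_FTC2 _ (fun s => psi (t - s)) (fun s => - primitive (t - s)))//.
- by rewrite subr0 -EFinB opprK addrC.
- apply: continuous_subspaceT => s.
  apply: (@continuous_comp _ _ _ (fun s => t - s) psi); last exact: cpsi.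
  by apply: cvgB; [exact: cvg_cst|exact: cvg_id].
- have cF : continuous (fun s => - primitive (t - s)).
    by apply: derivable1_continuous => s; have [] := dF s.
  split; first by move=> s _; have [] := dF s.
  + exact/cvg_at_right_filter/cF.
  + exact/cvg_at_left_filter/cF.
- by move=> s _; apply: is_derive1E.
Qed.

End primitive.

Section tensor.
Variable R : realType.

(** Reduces a directional derivative to the derivative of a function of one real
    variable. *)
Lemma is_derive_line (V : normedModType R) (F : V -> R) (x v : V) (d : R) :
  is_derive (0 : R) 1 (fun t : R => F (t *: v + x)) d -> is_derive x v F d.
Proof.
move=> [dF <-]; apply: DeriveDef; first exact/derivable1P.
rewrite /derive; set g1 := fun h => h^-1 *: _; set g2 := fun h => h^-1 *: _.
suff -> : g1 = g2 by [].
by apply/funext => h; rewrite /g1 /g2/= addr0 scale0r add0r [_%:A]mulr1.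
Qed.

Variable n : nat.

Definition tensor (f : 'I_n -> R -> R) (x : 'rV[R]_n) : R := \prod_i f i (x 0 i).

Lemma continuous_tensor (f : 'I_n -> R -> R) :
  (forall i, continuous (f i)) -> continuous (tensor f).
Proof.
move=> cf x; apply: (@cvg_big R 'I_n *%R 1 xpredT (@mul_continuous R) _ (nbhs x)
  (index_enum _) (fun i (y : 'rV[R]_n) => f i (y 0 i))) => i _.
apply: (@continuous_comp _ _ _ (fun x : 'rV[R]_n => x 0 i) (f i)); last exact: cf.
exact: coord_continuous.
Qed.

Lemma is_derive_tensor (f : 'I_n -> R -> R) i (x : 'rV[R]_n) (d : R) :
  is_derive (x 0 i) 1 (f i) d ->
  is_derive x (delta_mx 0 i) (tensor f) (d * \prod_(j | j != i) f j (x 0 j)).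
Proof.
move=> df; apply: is_derive_line.
rewrite (_ : (fun t => _) =
    fun t : R => f i (t + x 0 i) * \prod_(j | j != i) f j (x 0 j)); last first.
  apply/funext => t; rewrite /tensor (bigD1 i)//= !mxE !eqxx mulr1.
  congr (_ * _); apply: eq_bigr => j ji; rewrite !mxE eqxx/= (negbTE ji).
  by rewrite mulr0 add0r.
have d0 : is_derive (0 : R) 1 (f i \o shift (x 0 i)) (d * 1).
  apply: is_derive1_comp; last exact: is_derive_shift.
  by rewrite /= add0r.
rewrite mulr1 in d0.
set c := \prod_(j | j != i) f j (x 0 j).
have dc : is_derive (0 : R) (1 : R) (cst c : R -> R) (0 : R) by exact: is_derive_cst.
by apply: (is_derive_eq (is_deriveM d0 dc)); rewrite scaler0 add0r mulrC.
Qed.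

Lemma partial_tensor (f : 'I_n -> R -> R) i : (forall t, derivable (f i) t 1) ->
  partial i (tensor f) = tensor (fun j => if j == i then derive1 (f i) else f j).
Proof.
move=> df; apply/funext => x; rewrite /partial.
have dx : is_derive (x 0 i) 1 (f i) (derive1 (f i) (x 0 i)).
  by rewrite derive1E; exact: derivableP.
have := is_derive_tensor dx => h; rewrite derive_val.
rewrite /tensor [RHS](bigD1 i)//= eqxx; congr (_ * _).
by apply: eq_bigr => j /negbTE ->.
Qed.

Lemma Ck_tensor k (f : 'I_n -> R -> R) :
  (forall i m, smooth m (f i)) -> Ck k (tensor f).
Proof.
elim: k f => [|k IH] f sf; split => //;
  try by apply: continuous_tensor => i; exact: (sf i 0%N).
move=> i; split=> [x|].
  have [df _] := sf i 1%N.
  have dx : is_derive (x 0 i) 1 (f i) (derive1 (f i) (x 0 i)).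
    by rewrite derive1E; exact: derivableP.
  by have [] := is_derive_tensor dx.
rewrite partial_tensor; last exact: (sf i 1%N).1.
by apply: IH => j m; case: ifPn => // _; exact: (sf i m.+1).2.
Qed.

End tensor.

(** * Averages along segments *)

Section average.
Variables (R : realType) (n : nat).
Local Notation mu := (lebesgue_rV R n.+1).
Local Notation leb := (@lebesgue_measure R).
Definition e1 {R : realType} {n : nat} : 'rV[R]_n.+1 := delta_mx 0 ord0.

Lemma integral_restrict_mul (I : set R) (F : R -> R) : measurable I ->
  (\int[leb]_(s in I) (F s)%:E = \int[leb]_s (\1_I s * F s)%:E)%E.
Proof.
move=> mI; rewrite integral_mkcond; apply: eq_integral => s _.
by rewrite patchE indicE; case: ifPn => _; rewrite ?mul1r ?mul0r.
Qed.

Lemma measurable_slide (c : R) :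
  measurable_fun setT (fun p : 'rV[R]_n.+1 * R => p.1 + (c * p.2) *: e1).
Proof.
apply: measurable_rVP => i.
rewrite (_ : (fun _ => _) = fun p : 'rV[R]_n.+1 * R =>
    p.1 0 i + p.2 * (c * (e1 : 'rV[R]_n.+1) 0 i)); last first.
  by apply/funext => p; rewrite !mxE; ring.
apply: measurable_funD.
  apply: (measurableT_comp (measurable_rV_coord i)); exact: measurable_fst.
by apply: measurable_funM => //; exact: measurable_snd.
Qed.

Lemma measurable_slideD :
  measurable_fun setT (fun p : 'rV[R]_n.+1 * R => p.1 + p.2 *: e1).
Proof.
rewrite (_ : (fun _ => _) = fun p : 'rV[R]_n.+1 * R => p.1 + (1 * p.2) *: e1).
  exact: measurable_slide.
by apply/funext => p; rewrite mul1r.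
Qed.

Lemma measurable_slideB :
  measurable_fun setT (fun p : 'rV[R]_n.+1 * R => p.1 - p.2 *: e1).
Proof.
rewrite (_ : (fun _ => _) = fun p : 'rV[R]_n.+1 * R => p.1 + (-1 * p.2) *: e1).
  exact: measurable_slide.
by apply/funext => p; rewrite mulN1r scaleNr.
Qed.

Lemma measurable_line (F : 'rV[R]_n.+1 -> R) x : measurable_fun setT F ->
  measurable_fun setT (fun s : measurableTypeR R => F (x + s *: e1)).
Proof.
move=> mF; apply: (measurableT_comp mF).
exact: (measurableT_comp measurable_slideD (pair1_measurable x)).
Qed.

Variables (h : R) (g psi : 'rV[R]_n.+1 -> R).
Hypotheses (h0 : 0 < h) (ig : mu.-integrable setT (EFin \o g)).
Hypotheses (mpsi : measurable_fun setT psi) (psi1 : forall x, `|psi x| <= 1).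
Local Notation I := (`[0, h]%classic : set R).
Let mI : measurable (I : set (measurableTypeR R)). Proof. exact: measurable_itv. Qed.
Let mg : measurable_fun setT g.
Proof. by have /measurable_EFinP := measurable_int _ ig. Qed.

Definition average (g : 'rV[R]_n.+1 -> R) (x : 'rV[R]_n.+1) : \bar R :=
  (\int[leb]_(s in I) (g (x + s *: e1))%:E)%E.

Lemma integrable_slide : (mu \x leb)%E.-integrable setT
  (fun p : 'rV[R]_n.+1 * measurableTypeR R => (\1_I p.2 * g (p.1 + p.2 *: e1))%:E).
Proof.
have mf : measurable_fun setT (fun p : 'rV[R]_n.+1 * measurableTypeR R => (\1_I p.2 * g (p.1 + p.2 *: e1))%:E).
  apply/measurable_EFinP; apply: measurable_funM.
    apply: (measurableT_comp (measurable_indic mI)); exact: measurable_snd.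
  exact: (measurableT_comp mg measurable_slideD).
apply/(integrable21ltyP _ _ mf).
rewrite [ltLHS](_ : _ = \int[leb]_s (\1_I s * fine (\int[mu]_x `|(g x)%:E|))%:E)%E.
  rewrite -integral_restrict_mul// integral_cst//= lebesgue_measure_itv/= lte_fin h0.
  by rewrite -EFinB -EFinM ltry.
apply: eq_integral => s _.
transitivity (\int[mu]_x (`|(\1_I s)%:E| * `|(g (x + s *: e1))%:E|))%E.
  by apply: eq_integral => x _; rewrite EFinM abseM.
rewrite ge0_integralZl//; last first.
  apply/measurableT_comp => //; apply/measurable_EFinP.
  exact: (@measurable_fun_shift _ _ (s *: e1) _ _ g mg).
have -> : (\int[mu]_x `|(g (x + s *: e1))%:E| = \int[mu]_x `|(g x)%:E|)%E.
  apply: (@ge0_integral_shift _ _ (s *: e1) (fun x => `|(g x)%:E|)%E) => //.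
  by apply/measurableT_comp => //; exact/measurable_EFinP.
rewrite EFinM gee0_abs ?lee_fin//; congr (_ * _)%E; rewrite fineK//.
rewrite ge0_fin_numE ?integral_ge0//; by move/integrableP : ig => [].
Qed.

Lemma integrable_average : mu.-integrable setT (average g).
Proof.
rewrite (_ : average g = fun x => \int[leb]_s (\1_I s * g (x + s *: e1))%:E)%E.
  exact: (integrable_fubini_F integrable_slide).
by apply/funext => x; rewrite /average integral_restrict_mul.
Qed.

Let f1 (p : 'rV[R]_n.+1 * measurableTypeR R) : \bar R :=
  (\1_I p.2 * (g p.1 * psi (p.1 - p.2 *: e1)))%:E.
Let f2 (p : 'rV[R]_n.+1 * measurableTypeR R) : \bar R :=
  (\1_I p.2 * (g (p.1 + p.2 *: e1) * psi p.1))%:E.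

Let mf1 : measurable_fun setT f1.
Proof.
apply/measurable_EFinP; apply: measurable_funM.
  apply: (measurableT_comp (measurable_indic mI)); exact: measurable_snd.
apply: measurable_funM; first exact: (measurableT_comp mg measurable_fst).
exact: (measurableT_comp mpsi measurable_slideB).
Qed.

Let f2i : (mu \x leb)%E.-integrable setT f2.
Proof.
have i0 := integrable_slide.
apply: (le_integrable _ _ _ i0) => //.
  rewrite (_ : f2 = fun p => (\1_I p.2 * g (p.1 + p.2 *: e1))%:E * (psi p.1)%:E)%E; last first.
    by apply/funext => p; rewrite /f2 -EFinM mulrA.
  apply: emeasurable_funM; first exact: measurable_int i0.
  apply/measurable_EFinP; exact: (measurableT_comp mpsi measurable_fst).
move=> p _; rewrite /f2 mulrA EFinM abseM -[leRHS]mule1 lee_wpmul2l//.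
by rewrite lee_fin.
Qed.

Let f12 s : (\int[mu]_x f1 (x, s) = \int[mu]_x f2 (x, s))%E.
Proof.
rewrite -(@integral_shift _ _ (s *: e1) (fun x => f1 (x, s))).
  by apply: eq_integral => x _; rewrite /f1 /f2/= addrK.
exact: (measurableT_comp mf1 (pair2_measurable s)).
Qed.

Let f12abs s : (\int[mu]_x `|f1 (x, s)| = \int[mu]_x `|f2 (x, s)|)%E.
Proof.
rewrite -(@ge0_integral_shift _ _ (s *: e1) (fun x => `|f1 (x, s)|%E))//.
  by apply: eq_integral => x _; rewrite /f1 /f2/= addrK.
apply: measurableT_comp => //.
exact: (measurableT_comp mf1 (pair2_measurable s)).
Qed.

Let f1i : (mu \x leb)%E.-integrable setT f1.
Proof.
apply/(integrable21ltyP _ _ mf1).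
under eq_integral do rewrite f12abs.
by apply/(integrable21ltyP _ _ (measurable_int _ f2i)).
Qed.

(** Fubini's theorem, together with the translation [x -> x + s e1] for each fixed
    [s], moves the averaging from the test function to [g]. *)
Lemma average_dual (Psi : 'rV[R]_n.+1 -> R) :
  (forall x, \int[leb]_(s in I) (psi (x - s *: e1))%:E = (Psi x)%:E)%E ->
  (\int[mu]_x (g x * Psi x)%:E = \int[mu]_x ((psi x)%:E * average g x))%E.
Proof.
move=> PsiE.
transitivity (\int[mu]_x \int[leb]_s f1 (x, s))%E.
  apply: eq_integral => x _; rewrite EFinM -PsiE integral_restrict_mul//.
  (* The integral over s is over a bounded set, and psi is bounded. *)
  rewrite -integralZl//.
    by apply: eq_integral => s _; rewrite /f1/= -EFinM mulrCA.
  apply: (@le_integrable _ _ _ leb _ measurableT _ (EFin \o (\1_I : measurableTypeR R -> R))).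
  - apply/measurable_EFinP; apply: measurable_funM; first exact: measurable_indic.
    apply: (measurableT_comp mpsi).
    exact: (measurableT_comp measurable_slideB (pair1_measurable x)).
  - move=> s _; rewrite EFinM abseM -[leRHS]mule1 lee_wpmul2l//.
    by rewrite lee_fin.
  - exact: integrable_indic_itv.
rewrite (Fubini f1i).
under eq_integral do rewrite f12.
rewrite -(Fubini f2i).
apply: ae_eq_integral => //.
- exact: measurable_int (integrable_fubini_F f2i).
- apply: emeasurable_funM; first exact/measurable_EFinP.
  exact: measurable_int integrable_average.
apply: filterS (ae_integrable1 integrable_slide) => x ix _.
rewrite /average integral_restrict_mul// -integralZl//.
by apply: eq_integral => s _; rewrite /f2/= -EFinM; congr EFin; ring.
Qed.

End average.

(** * Test functions adapted to a box *)

Section box_test.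
Variables (R : realType) (n : nat).
Local Notation leb := (@lebesgue_measure R).
Variables (h : R) (a b : 'I_n.+1 -> R).
Hypotheses (h0 : 0 < h) (ab : forall i, a i <= b i).

Definition bumps N (i : 'I_n.+1) : R -> R := bump N (a i) (b i).

(** The first factor is a bump averaged over the segments of length [h]; its
    derivative is a difference of two translates of the bump, so that testing a weak
    derivative against the tensor product yields an increment of the function. *)
Definition slid_bumps N (i : 'I_n.+1) : R -> R :=
  if i == ord0 then
    fun t => primitive (bumps N ord0) t - primitive (bumps N ord0) (t - h)
  else bumps N i.

Let bumps0 N i t : ~~ (a i < t < b i) -> bumps N i t = 0.
Proof. exact: bump_eq0. Qed.

Let cbumps N i : continuous (bumps N i).
Proof. by apply: (@smooth_continuous _ 0); exact: smooth_bump. Qed.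

Lemma is_derive_slid N t : is_derive t (1 : R)
  (slid_bumps N ord0) (bumps N ord0 t - bumps N ord0 (t - h)).
Proof.
rewrite /slid_bumps eqxx.
have dP := is_derive_primitive (@cbumps N ord0) (@bumps0 N ord0).
have d2 : is_derive t (1 : R) (primitive (bumps N ord0) \o (shift (- h)))
    (bumps N ord0 (t - h) * 1).
  exact: (@is_derive1_comp R _ (shift (- h)) t _ _ (dP (t - h)) (is_derive_shift t 1 (- h))).
rewrite mulr1 in d2; exact: is_deriveB (dP t) d2.
Qed.

Lemma smooth_slid_bumps N i k : smooth k (slid_bumps N i).
Proof.
rewrite /slid_bumps; case: ifPn => i0; last exact: smooth_bump.
have sP : smooth k (primitive (bumps N ord0)).
  apply: smoothW; apply: (smooth_primitive (@cbumps N ord0) (@bumps0 N ord0)).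
  exact: smooth_bump.
apply: smoothD => //.
rewrite (_ : (fun _ => _) = fun t => (-1) * primitive (bumps N ord0) (1 * t + (- h))).
  apply: (@smoothM _ k (fun=> -1)); first exact: smooth_cst.
  exact: smooth_affine.
by apply/funext => t; rewrite mul1r mulN1r.
Qed.

Lemma Ck_slid_bumps N k : Ck k (tensor (slid_bumps N)).
Proof. by apply: Ck_tensor => i m; exact: smooth_slid_bumps. Qed.

Lemma tensor_shift (f : 'I_n.+1 -> R -> R) (x : 'rV[R]_n.+1) s :
  tensor f (x - s *: e1) = f ord0 (x 0 ord0 - s) * \prod_(i | i != ord0) f i (x 0 i).
Proof.
rewrite /tensor (bigD1 ord0)//= !mxE !eqxx mulr1; congr (_ * _).
by apply: eq_bigr => i i0; rewrite !mxE eqxx/= (negbTE i0) mulr0 subr0.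
Qed.

Lemma integral_tensor_bumps N (x : 'rV[R]_n.+1) :
  (\int[leb]_(s in `[0%R, h]) (tensor (bumps N) (x - s *: e1))%:E =
   (tensor (slid_bumps N) x)%:E)%E.
Proof.
under eq_integral do rewrite tensor_shift EFinM.
rewrite integralZr//.
- rewrite (integral_primitive (@cbumps N ord0) (@bumps0 N ord0) _ h0).
  rewrite -EFinM; congr EFin.
  rewrite /tensor [RHS](bigD1 ord0)//= {1}/slid_bumps eqxx; congr (_ * _).
  by apply: eq_bigr => i i0; rewrite /slid_bumps (negbTE i0).
- apply: (@continuous_compact_integrable _ (fun s => bumps N ord0 (x 0 ord0 - s))).
    exact: segment_compact.
  apply: continuous_subspaceT => s.
  apply: (@continuous_comp _ _ _ (fun s => x 0 ord0 - s) (bumps N ord0)).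
    by apply: cvgB; [exact: cvg_cst|exact: cvg_id].
  exact: cbumps.
Qed.

Lemma partial_slid_bumps N x : partial ord0 (tensor (slid_bumps N)) x =
  tensor (bumps N) x - tensor (bumps N) (x - h *: e1).
Proof.
rewrite partial_tensor; last by move=> t; have [] := is_derive_slid N t.
rewrite -[X in _ = tensor _ X - _]subr0 -(scale0r e1) !tensor_shift subr0 -mulrBl.
rewrite /tensor (bigD1 ord0)//=; congr (_ * _).
  exact: is_derive1E (is_derive_slid _ _).
by apply: eq_bigr => i i0; rewrite (negbTE i0) /slid_bumps (negbTE i0).
Qed.

Lemma tensor_neq0 (f : 'I_n.+1 -> R -> R) (x : 'rV[R]_n.+1) :
  tensor f x != 0 -> forall i, f i (x 0 i) != 0.
Proof. by move=> /prodf_neq0 h1 i; exact: h1. Qed.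

Lemma tensor_bumps_obox N x : tensor (bumps N) x != 0 -> obox a b x.
Proof.
move=> /tensor_neq0 h1 i; apply/negPn/negP => h2; have := h1 i.
by rewrite bumps0// eqxx.
Qed.

Lemma tensor_bumps_le1 N x : `|tensor (bumps N) x| <= 1.
Proof.
rewrite /tensor normr_prod; apply: (@le_trans _ _ (\prod_(i < n.+1) (1 : R))).
  by apply: ler_prod => i _; rewrite normr_ge0 ger0_norm ?bump_ge0// bump_le1.
by rewrite big1.
Qed.

Lemma tensor_bumps_cvg (x : 'rV[R]_n.+1) :
  tensor (bumps N) x @[N --> \oo] --> (\1_(obox a b) x : R).
Proof.
have -> : \1_(obox a b) x = \prod_i ((a i < x 0 i < b i)%R%:R : R).
  rewrite indicE; have [/set_mem xab|/negP xab] := boolP (x \in obox a b).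
    by rewrite big1// => i _; rewrite (xab i).
  have [i /negP hi] : exists i, ~ (a i < x 0 i < b i).
    by apply/existsNP => h1; apply: xab; rewrite inE.
  by rewrite (bigD1 i)//= (negbTE hi) mul0r.
apply: (@cvg_big R 'I_n.+1 *%R 1 xpredT (@mul_continuous R) _ \oo
  (index_enum _) (fun i N => bumps N i (x 0 i))) => i _.
exact: bump_cvg.
Qed.

(** A point of the support lies on a segment of length at most [h] that starts in
    the closed box and points in the direction [e1]. *)
Lemma tensor_slid_bumps_support N (x : 'rV[R]_n.+1) : tensor (slid_bumps N) x != 0 ->
  exists2 s, 0 <= s <= h & forall i, a i <= (x - s *: e1) 0 i <= b i.
Proof.
move=> /tensor_neq0 hx.
have hi i : i != ord0 -> a i <= x 0 i <= b i.
  move=> i0; have := hx i; rewrite /slid_bumps (negbTE i0) => h1.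
  have : a i < x 0 i < b i.
    by apply/negPn/negP => h2; move: h1; rewrite bumps0// eqxx.
  by move=> /andP[/ltW -> /ltW ->].
have : a ord0 < x 0 ord0 < b ord0 + h.
  have := hx ord0; rewrite /slid_bumps eqxx; apply: contraNT.
  rewrite negb_and -!leNgt => /orP[h1|h1].
    have hb := @primitive_le _ _ _ _ (@bumps0 N ord0).
    rewrite (hb (x 0 ord0))// (hb (x 0 ord0 - h)) ?subrr//.
    by rewrite lerBlDr; apply: (le_trans h1); rewrite lerDl ltW.
  have hb := @primitive_ge _ _ _ _ (@bumps0 N ord0).
  rewrite (hb (x 0 ord0 - h)) ?lerBrDr// (hb (x 0 ord0)) ?subrr//.
  by apply: le_trans h1; rewrite lerDl ltW.
move=> /andP[xa xb].
(* The shortest slide that brings the first coordinate below b. *)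
pose s := Num.max 0 (x 0 ord0 - b ord0).
have ab0 := ab ord0.
exists s; first by rewrite /s le_max lexx/= ge_max (ltW h0)/=; lra.
move=> i; have [->|i0] := eqVneq i ord0.
  rewrite !mxE !eqxx mulr1 /s.
  by have [|] := leP 0 (x 0 ord0 - b ord0) => ?; apply/andP; split; lra.
by rewrite !mxE eqxx (negbTE i0) mulr0 subr0 hi.
Qed.

End box_test.

(** * Increments of weakly differentiable functions *)

Section weak_to_ae.
Variables (R : realType) (n : nat).
Local Notation mu := (lebesgue_rV R n.+1).
Variables (U K : set 'rV[R]_n.+1) (v g : 'rV[R]_n.+1 -> R).
Hypotheses (oU : open U) (cK : compact K) (KU : K `<=` U).
Hypothesis wvg : weak_partial U ord0 v g.

Let clK : closed K. Proof. by apply: compact_closed => //; exact: norm_hausdorff. Qed.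
Let mK : measurable K. Proof. exact: closed_rV_measurable. Qed.
Let mU : measurable U. Proof. exact: open_rV_measurable. Qed.

Lemma L1loc_integrable f : L1loc U f -> mu.-integrable setT (EFin \o (f \_ K)).
Proof.
move=> [mf fi]; rewrite -restrict_EFin; apply/(integrable_mkcond _ mK).
apply/integrableP; split; last exact: (fi K cK KU).
apply/measurable_EFinP; exact: measurable_funS mf.
Qed.

Let V : 'rV[R]_n.+1 -> R := v \_ K.
Let W : 'rV[R]_n.+1 -> R := g \_ K.
Let iV : mu.-integrable setT (EFin \o V).
Proof. by apply: L1loc_integrable; case: wvg. Qed.
Let iW : mu.-integrable setT (EFin \o W).
Proof. by apply: L1loc_integrable; case: wvg. Qed.

Variables (h : R).
Hypothesis h0 : 0 < h.

Let D (x : 'rV[R]_n.+1) : R := V (x + h *: e1) - V x.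

Let iVh : mu.-integrable setT (fun x => (V (x + h *: e1))%:E).
Proof. exact: (integrable_shift (h *: e1) iV). Qed.

Let iD : mu.-integrable setT (EFin \o D).
Proof.
rewrite (_ : EFin \o D = (fun x => (V (x + h *: e1))%:E - (V x)%:E)%E).
  exact: integrableB.
by apply/funext => x; rewrite /= EFinB.
Qed.

Section box.
Variables a b : 'I_n.+1 -> R.
Hypothesis ab : forall i, a i <= b i.
Hypothesis boxK : forall x : 'rV[R]_n.+1, (forall i, a i <= x 0 i <= b i) ->
  forall s, 0 <= s <= h -> K (x + s *: e1).

Let psi N := tensor (bumps a b N).
Let Psi N := tensor (slid_bumps h a b N).

Let cpsi N : continuous (psi N).
Proof. by apply: continuous_tensor => i; apply: (@smooth_continuous _ 0); exact: smooth_bump. Qed.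

Let mpsi N : measurable_fun setT (psi N).
Proof. exact: continuous_rV_measurable. Qed.

Let psi_K N x : psi N x != 0 -> K x /\ K (x + h *: e1).
Proof.
move=> /tensor_bumps_obox xab.
have xc i : a i <= x 0 i <= b i by have /andP[/ltW -> /ltW ->] := xab i.
split; last by apply: boxK => //; rewrite lexx ltW.
by rewrite -[x]addr0 -(scale0r e1); apply: boxK => //; rewrite lexx ltW.
Qed.

Let Psi_K N x : Psi N x != 0 -> K x.
Proof.
move=> /tensor_slid_bumps_support-/(_ h0 ab)[s s01 xs].
by rewrite -(subrK (s *: e1) x); exact: boxK.
Qed.

Lemma test_function_Psi N : test_function U (Psi N).
Proof.
have sub : closure [set x | Psi N x != 0] `<=` K.
  by move/closure_id : clK => ->; apply: closureS => x; exact: Psi_K.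
split.
- by move=> k; exact: Ck_slid_bumps.
- apply: subclosed_compact cK sub; exact: closed_closure.
- exact: subset_trans KU.
Qed.

Let bounded_integrable (f w : 'rV[R]_n.+1 -> R) : mu.-integrable setT (EFin \o f) ->
  measurable_fun setT w -> (forall x, `|w x| <= 1) ->
  mu.-integrable setT (fun x => (f x * w x)%:E).
Proof.
move=> fi mw w1; apply: (le_integrable _ _ _ fi) => //.
  apply/measurable_EFinP; apply: measurable_funM => //.
  by apply/measurable_EFinP; exact: measurable_int fi.
by move=> x _; rewrite /= lee_fin normrM ler_piMr.
Qed.

(** The definition of the weak derivative for the slid bumps. The left-hand side
    becomes an increment by translation invariance, the right-hand side an average by
    [average_dual]. Extending [v] and [g] by 0 off the compact set [K] is harmless,
    since the test function and its derivative vanish there. *)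
Lemma weak_difference N :
  (\int[mu]_x (D x * psi N x)%:E = \int[mu]_x ((psi N x)%:E * average h W x))%E.
Proof.
have psi1 x : `|psi N x| <= 1 by exact: tensor_bumps_le1.
rewrite -(@average_dual _ _ _ _ _ h0 iW (mpsi N) psi1 (Psi N)); last first.
  by move=> x; exact: integral_tensor_bumps.
have [_ _ /(_ _ (test_function_Psi N))] := wvg.
rewrite [X in X = _ -> _]integral_mkcond [X in _ = (- X)%E -> _]integral_mkcond.
have -> : ((fun x => (v x * partial ord0 (Psi N) x)%:E) \_ U =
    (fun x => (V x * psi N x)%:E - (V x * psi N (x - h *: e1))%:E)%E).
  apply/funext => x; rewrite patchE partial_slid_bumps// -EFinB -mulrBr /V patchE.
  have [xK|/negP xK] := boolP (x \in K).
    by rewrite mem_set//; apply: KU; exact: set_mem.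
  rewrite mul0r; case: ifPn => // _.
  have [->|/psi_K[xK' _]] := eqVneq (tensor (bumps a b N) x) 0; last first.
    by exfalso; apply: xK; rewrite inE.
  have [->|/psi_K[_ xK']] := eqVneq (tensor (bumps a b N) (x - h *: e1)) 0; last first.
    by exfalso; apply: xK; rewrite inE -(subrK (h *: e1) x).
  by rewrite subrr mulr0.
have -> : ((fun x => (g x * Psi N x)%:E) \_ U = (fun x => (W x * Psi N x)%:E)).
  apply/funext => x; rewrite patchE /W patchE.
  have [xK|/negP xK] := boolP (x \in K).
    by rewrite mem_set//; apply: KU; exact: set_mem.
  rewrite mul0r; case: ifPn => // _.
  have [->|/Psi_K xK'] := eqVneq (Psi N x) 0; first by rewrite mulr0.
  by exfalso; apply: xK; rewrite inE.
have mpsih : measurable_fun setT (fun x : 'rV[R]_n.+1 => psi N (x - h *: e1)).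
  exact: (measurable_fun_shift (- (h *: e1)) (mpsi N)).
rewrite integralB//; [|exact: bounded_integrable|]; last first.
  by apply: bounded_integrable => // x; exact: tensor_bumps_le1.
have -> : (\int[mu]_x (V x * psi N (x - h *: e1))%:E =
   \int[mu]_x (V (x + h *: e1) * psi N x)%:E)%E.
  rewrite -(@integral_shift _ _ (h *: e1) (fun x => (V x * psi N (x - h *: e1))%:E)).
    by apply: eq_integral => x _; rewrite addrK.
  apply/measurable_EFinP; apply: measurable_funM => //.
  by apply/measurable_EFinP; exact: measurable_int iV.
have i1 : mu.-integrable setT (fun x => (V (x + h *: e1) * psi N x)%:E).
  exact: (@bounded_integrable (fun x => V (x + h *: e1))).
have i2 : mu.-integrable setT (fun x => (V x * psi N x)%:E).
  exact: bounded_integrable.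
have -> : (\int[mu]_x (D x * psi N x)%:E =
  \int[mu]_x (V (x + h *: e1) * psi N x)%:E - \int[mu]_x (V x * psi N x)%:E)%E.
  rewrite -integralB//; apply: eq_integral => x _.
  by rewrite -EFinB -mulrBl.
move=> /(congr1 oppe); rewrite oppeK => <-.
have /fineK <- := integrable_fin_num measurableT i1.
have /fineK <- := integrable_fin_num measurableT i2.
by rewrite -!EFinB -EFinN opprB.
Qed.

Lemma box_difference :
  (\int[mu]_(x in obox a b) (D x)%:E = \int[mu]_(x in obox a b) average h W x)%E.
Proof.
have mab := measurable_obox a b.
have iA := integrable_average h0 iW.
have mD : measurable_fun setT D by apply/measurable_EFinP; exact: measurable_int iD.
have c1 : (\int[mu]_x (D x * psi N x)%:E @[N --> \oo] -->
    \int[mu]_(x in obox a b) (D x)%:E)%E.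
  rewrite [X in _ --> X]integral_mkcond.
  have [|||||_ _ ] := @dominated_convergence _ _ _ mu setT measurableT
     (fun N x => (D x * psi N x)%:E) ((EFin \o D) \_ (obox a b)) (fun x => `|(D x)%:E|%E).
  - move=> N; apply/measurable_EFinP; exact: measurable_funM.
  - apply/(measurable_restrictT _ mab); apply: measurable_funTS.
    exact: measurable_int iD.
  - apply/aeW => x _; rewrite patchE -[X in _ --> X](_ : (D x * \1_(obox a b) x)%:E = _)%E.
      apply: cvg_EFin; first exact: nearW.
      by apply: cvgM; [exact: cvg_cst|exact: tensor_bumps_cvg].
    by rewrite indicE; case: ifPn => _; rewrite ?mulr1 ?mulr0.
  - exact: integrable_abse.
  - apply/aeW => x N _; rewrite EFinM abseM -[leRHS]mule1 lee_wpmul2l//.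
    by rewrite lee_fin; exact: tensor_bumps_le1.
  - by [].
have c2 : (\int[mu]_x ((psi N x)%:E * average h W x) @[N --> \oo] -->
    \int[mu]_(x in obox a b) average h W x)%E.
  rewrite [X in _ --> X]integral_mkcond.
  have [|||||_ _ ] := @dominated_convergence _ _ _ mu setT measurableT
     (fun N x => (psi N x)%:E * average h W x)%E ((average h W) \_ (obox a b))
     (fun x => `|average h W x|%E).
  - move=> N; apply: emeasurable_funM; first exact/measurable_EFinP.
    exact: measurable_int iA.
  - apply/(measurable_restrictT _ mab); apply: measurable_funTS.
    exact: measurable_int iA.
  - apply: filterS (integrable_ae measurableT iA) => x /(_ Logic.I) fx _.
    have -> : (average h W \_ (obox a b)) x =
        (\1_(obox a b) x * fine (average h W x))%:E.
      by rewrite patchE indicE; case: ifPn => _; rewrite ?mul1r ?mul0r ?fineK.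
    rewrite (_ : (fun N => _) = fun N => (psi N x * fine (average h W x))%:E).
      apply: cvg_EFin; first exact: nearW.
      by apply: cvgM; [exact: tensor_bumps_cvg|exact: cvg_cst].
    by apply/funext => N; rewrite EFinM fineK.
  - exact: integrable_abse.
  - apply/aeW => x N _; rewrite abseM -[leRHS]mul1e lee_wpmul2r//.
    by rewrite lee_fin; exact: tensor_bumps_le1.
  - by [].
have E : (fun N => \int[mu]_x ((psi N x)%:E * average h W x))%E =
    (fun N => \int[mu]_x (D x * psi N x)%:E)%E.
  by apply/funext => N; rewrite weak_difference.
rewrite E in c2; exact: (cvg_unique (@ereal_hausdorff R) c1 c2).
Qed.

End box.

(** On a fine enough grid every cube that meets [A], together with its slides along
    [e1], stays in [K]; [box_difference] then applies to all boxes inside that cube,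
    and countably many cubes cover the space. *)
Lemma ae_difference (A : set 'rV[R]_n.+1) (r : R) : 0 < r ->
  (forall x, A x -> forall y : 'rV[R]_n.+1, (forall i, `|y 0 i - x 0 i| <= r) ->
    forall s, 0 <= s <= h -> K (y + s *: e1)) ->
  {ae mu, forall x, A x -> (D x)%:E = average h W x}.
Proof.
move=> r0 AK; have iA := integrable_average h0 iW.
pose N := Num.truncn (2 / r).
have Nr : 2 / N.+1%:R <= r.
  by rewrite ler_pdivrMr// mulrC -ler_pdivrMr// ltW// truncnS_gt.
pose P := [set x | (D x)%:E = average h W x].
pose bad (z : 'rV[int]_n.+1) :=
  if `[< A `&` gcube N z !=set0 >] then ~` [set x | gcube N z x -> P x] else set0.
suff badN z : mu.-negligible (bad z).
  apply: negligibleS (bigcup_countType_negligible badN) => x /=.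
  move=> /not_implyP[Ax Px]; have [z zx] := gcube_cover N x.
  exists z => //; rewrite /bad asboolT; last by exists x.
  by move=> /(_ zx).
rewrite /bad; case: asboolP => [[x0 [Ax0 zx0]]|_]; last exact: negligible_set0.
apply: obox_integral_ae_eq => // a b.
rewrite oboxI; set a' := fun i => Num.max _ _; set b' := fun i => Num.min _ _.
have [ab'|/existsNP[i /negP]] := pselect (forall i, a' i <= b' i); last first.
  rewrite -ltNge => ba.
  have -> : obox a' b' = set0.
    by apply/seteqP; split => // y /(_ i) /andP[h1 h2]; lra.
  by rewrite !integral_set0.
apply: box_difference => // y yab s sh.
apply: (AK x0) => // i.
move: (yab i) (zx0 i); rewrite /a' /b' ge_max le_min => /andP[/andP[_ y1] /andP[_ y2]].
move=> /andP[x1 x2]; apply: le_trans Nr.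
move: y1 y2 x1 x2; rewrite !mulrDl mulN1r mul1r; move: (_^-1) ((z 0 i)%:~R * _) => t w *.
by rewrite ler_norml; apply/andP; split; lra.
Qed.

End weak_to_ae.

(** * Powers of increments *)

Section power_increment.
Variable R : realType.
Implicit Types a b p t tau : R.

Lemma onem_exprn_le (m : nat) (r : R) : 0 <= r <= 1 -> 1 - r ^+ m <= m%:R * (1 - r).
Proof.
move=> /andP[r0 r1]; elim: m => [|m IH]; first by rewrite expr0 subrr mul0r.
rewrite exprS -natr1 mulrDl mul1r.
have -> : 1 - r * r ^+ m = r * (1 - r ^+ m) + (1 - r) by ring.
rewrite lerD2r; apply: le_trans IH; rewrite ler_piMl// subr_ge0.
exact: exprn_ile1.
Qed.

(** The tangent inequality for the convex power, with an integer [m >= p] as factor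
    in place of [p]: Bernoulli's inequality for integer exponents is then enough. *)
Lemma powR_increment (m : nat) p a b : 1 <= p -> p <= m%:R -> 0 <= a -> 0 <= b ->
  a `^ p <= b `^ p + m%:R * a `^ (p - 1) * `|a - b|.
Proof.
move=> p1 pm a0 b0; have p0 : 0 < p by lra.
have [ab|ba] := leP a b.
  apply: (@le_trans _ _ (b `^ p)); last first.
    by rewrite lerDl !mulr_ge0// powR_ge0.
  by apply: ge0_ler_powR => //; rewrite ?nnegrE// ltW.
have {}a0 : 0 < a by exact: le_lt_trans ba.
rewrite ger0_norm; last by rewrite subr_ge0 ltW.
pose r := b / a.
have r01 : 0 <= r <= 1 by rewrite divr_ge0 ?(ltW a0)//= ler_pdivrMr// mul1r ltW.
have bE : b = r * a by rewrite /r mulfVK// gt_eqF.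
have rp : r ^+ m <= r `^ p.
  have /andP[+ r1] := r01; rewrite le_eqVlt => /predU1P[<-|r0].
    rewrite expr0n powR0 ?gt_eqF//; case: m pm => [pm|//].
    by exfalso; lra.
  have r01' : 0 < r <= 1 by rewrite r0.
  rewrite -powR_mulrn; last exact: ltW.
  by have := ger_powR r01'; apply.
have := onem_exprn_le m r01 => h.
have -> : a - b = a * (1 - r) by rewrite bE; ring.
have /andP[r0 _] := r01.
rewrite [b]bE (powRM _ r0 (ltW a0)).
have -> : m%:R * a `^ (p - 1) * (a * (1 - r)) = a `^ p * (m%:R * (1 - r)).
  by rewrite -(mulr_powRB1 (ltW a0) p0); ring.
rewrite -lerBlDl -[X in X - _]mul1r -mulrBl mulrC ler_wpM2l ?powR_ge0//.
by apply: le_trans h; lra.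
Qed.

(** A form of Young's inequality. If [c t <= tau y] the first term on the right
    suffices; otherwise [y < (c / tau) t] and the second one does. *)
Lemma powR_absorb p tau (c : R) : 1 <= p -> 0 < tau -> 0 <= c ->
  exists2 C, 0 <= C & forall y t, 0 <= y -> 0 <= t ->
    c * y `^ (p - 1) * t <= tau * y `^ p + C * t `^ p.
Proof.
move=> p1 tau0 c0; have p0 : 0 < p by lra.
pose k := c / tau.
have k0 : 0 <= k by rewrite divr_ge0// ltW.
exists (c * k `^ (p - 1)); first by rewrite mulr_ge0// powR_ge0.
move=> y t y0 t0.
have [h|h] := leP (c * t) (tau * y).
  apply: (@le_trans _ _ (tau * y `^ p)).
    by rewrite mulrAC -(mulr_powRB1 y0 p0) mulrA ler_wpM2r ?powR_ge0.
  by rewrite lerDl !mulr_ge0 ?powR_ge0.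
apply: (@le_trans _ _ (c * k `^ (p - 1) * t `^ p)); last first.
  by rewrite lerDr mulr_ge0 ?powR_ge0// ltW.
rewrite -(mulr_powRB1 t0 p0).
have -> : c * k `^ (p - 1) * (t * t `^ (p - 1)) =
  c * t * (k `^ (p - 1) * t `^ (p - 1)) by ring.
rewrite mulrAC ler_wpM2l ?mulr_ge0// -powRM//.
apply: ge0_ler_powR; rewrite ?nnegrE ?subr_ge0 ?mulr_ge0 ?invr_ge0 ?(ltW tau0)//.
by rewrite /k mulrAC ler_pdivlMr// mulrC ltW.
Qed.

Local Notation leb := (@lebesgue_measure R).

(** The data [a], [b], [w] stand for the values of a function at both ends of a
    segment of length [h] and its derivative along the segment. *)
Definition increment_bound p tau (C : R) : Prop :=
  forall (h a b : R) (w : R -> R), 0 < h ->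
    measurable_fun setT w ->
    ((b - a)%:E = \int[leb]_(s in `[0%R, h]) (w s)%:E)%E ->
    ((`|a| `^ p)%:E <= (`|b| `^ p)%:E + (h * (tau * `|a| `^ p))%:E +
      C%:E * \int[leb]_(s in `[0%R, h]) (`|w s| `^ p)%:E)%E.

(** [powR_increment] bounds the increment of the power by
    [m |a|^(p-1) int |w|], and [powR_absorb] is applied inside that integral. *)
Lemma increment_bound_exists p tau : 1 <= p -> 0 < tau ->
  exists2 C, 0 <= C & increment_bound p tau C.
Proof.
move=> p1 tau0; pose m := (Num.truncn p).+1.
have pm : p <= m%:R by rewrite ltW// truncnS_gt.
have [C C0 HC] := powR_absorb p1 tau0 (ler0n R m).
exists C => // h a b w h0 mw abE.
have mI : measurable (`[0, h]%classic : set (measurableTypeR R)) by exact: measurable_itv.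
have mwp : measurable_fun setT (fun s => `|w s| `^ p).
  apply: (@measurableT_comp _ _ _ _ _ _ (@powR R ^~ p)); first exact: measurable_powR.
  exact: measurableT_comp.
have mwI (f : R -> R) : measurable_fun setT f ->
    measurable_fun (`[0, h] : set (measurableTypeR R)) (EFin \o f).
  by move=> mf; apply: measurable_funTS; exact/measurable_EFinP.
have step1 : (`|a - b|%:E <= \int[leb]_(s in `[0%R, h]) (`|w s|)%:E)%E.
  by rewrite distrC -abse_EFin abE; apply: le_abse_integral => //; exact: mwI.
have step2 : ((`|a| `^ p)%:E <= (`|b| `^ p)%:E +
    (m%:R * `|a| `^ (p - 1))%:E * \int[leb]_(s in `[0%R, h]) (`|w s|)%:E)%E.
  apply: (@le_trans _ _ ((`|b| `^ p)%:E +
    (m%:R * `|a| `^ (p - 1))%:E * `|a - b|%:E)%E); last first.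
    by rewrite leeD2l// lee_wpmul2l// lee_fin mulr_ge0 ?powR_ge0.
  rewrite -EFinM -EFinD lee_fin; apply: le_trans (powR_increment p1 pm _ (normr_ge0 b)) _ => //.
  by rewrite lerD2l ler_wpM2l ?mulr_ge0 ?powR_ge0// ler_dist_dist.
apply: (le_trans step2); rewrite -addeA leeD2l//.
have -> : (h * (tau * `|a| `^ p))%:E = (\int[leb]_(s in `[0%R, h]) (tau * `|a| `^ p)%:E)%E.
  by rewrite integral_cst//= lebesgue_measure_itv/= lte_fin h0 -EFinB -EFinM subr0 mulrC.
have Z (k : R) (f : R -> R) : 0 <= k -> measurable_fun setT f -> (forall s, 0 <= f s) ->
    (k%:E * \int[leb]_(s in `[0%R, h]) (f s)%:E =
     \int[leb]_(s in `[0%R, h]) (k * f s)%:E)%E.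
  move=> k0 mf f0; rewrite -ge0_integralZl//; first exact: mwI.
  by move=> s _; rewrite lee_fin.
have mw1 : measurable_fun setT (fun s => `|w s|) by exact: measurableT_comp.
have cp0 : 0 <= m%:R * `|a| `^ (p - 1) by rewrite mulr_ge0 ?powR_ge0.
rewrite (Z _ _ cp0 mw1)// (Z _ _ C0 mwp); last by move=> s; exact: powR_ge0.
rewrite -ge0_integralD//; last 3 first.
- by move=> s _; rewrite lee_fin mulr_ge0 ?powR_ge0// ltW.
- by move=> s _; rewrite lee_fin mulr_ge0 ?powR_ge0.
- by apply: (mwI (fun s => C * `|w s| `^ p)); exact: measurable_funM.
apply: ge0_le_integral => //.
- by apply: (mwI (fun s => m%:R * `|a| `^ (p - 1) * `|w s|)); apply: measurable_funM.
- apply: (mwI (fun s => tau * `|a| `^ p + C * `|w s| `^ p)).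
  by apply: measurable_funD => //; exact: measurable_funM.
- by move=> s _; rewrite -EFinD lee_fin HC.
Qed.

End power_increment.

(** * Integration by parts with difference quotients *)

Section tonelli_slide.
Variables (R : realType) (n : nat).
Local Notation mu := (lebesgue_rV R n.+1).
Local Notation leb := (@lebesgue_measure R).
Variables (h : R) (phi w : 'rV[R]_n.+1 -> R).
Hypotheses (mphi : measurable_fun setT phi) (mw : measurable_fun setT w).
Hypotheses (phi0 : forall x, 0 <= phi x) (w0 : forall x, 0 <= w x).
Local Notation I := (`[0, h]%classic : set R).
Let mI : measurable (I : set (measurableTypeR R)). Proof. exact: measurable_itv. Qed.

Lemma tonelli_slide :
  (\int[mu]_x ((phi x)%:E * \int[leb]_(s in I) (w (x + s *: e1))%:E) =
   \int[leb]_(s in I) \int[mu]_x (phi (x - s *: e1) * w x)%:E)%E.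
Proof.
pose F (p : 'rV[R]_n.+1 * measurableTypeR R) : \bar R :=
  (\1_I p.2 * (phi p.1 * w (p.1 + p.2 *: e1)))%:E.
have mF : measurable_fun setT F.
  apply/measurable_EFinP; apply: measurable_funM.
    apply: (measurableT_comp (measurable_indic mI)); exact: measurable_snd.
  apply: measurable_funM; first exact: (measurableT_comp mphi measurable_fst).
  exact: (measurableT_comp mw (@measurable_slideD R n)).
have F0 p : (0 <= F p)%E by rewrite lee_fin !mulr_ge0.
have mws x := measurable_line x mw.
transitivity (\int[mu]_x \int[leb]_s F (x, s))%E.
  apply: eq_integral => x _; rewrite -ge0_integralZl//; last 3 first.
  - by apply/measurable_EFinP; exact: measurable_funTS (mws x).
  - by move=> s _; rewrite lee_fin.
  - by rewrite lee_fin.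
  under eq_integral do rewrite -EFinM.
  by rewrite integral_restrict_mul.
rewrite (fubini_tonelli _ mF F0) [RHS]integral_mkcond; apply: eq_integral => s _.
rewrite patchE; case: ifPn => sI; last first.
  by rewrite integral0_eq// => x _; rewrite /F/= indicE (negbTE sI) mul0r.
rewrite -(@ge0_integral_shift _ _ (- (s *: e1)) (fun x => F (x, s)))//.
  by apply: eq_integral => x _; rewrite /F/= indicE sI mul1r subrK.
exact: (measurableT_comp mF (pair2_measurable s)).
Qed.

End tonelli_slide.

Section core.
Variables (R : realType) (n : nat).
Local Notation mu := (lebesgue_rV R n.+1).
Local Notation leb := (@lebesgue_measure R).
Variables (U K : set 'rV[R]_n.+1) (v g : 'rV[R]_n.+1 -> R).
Hypotheses (oU : open U) (cK : compact K) (KU : K `<=` U).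
Hypothesis wvg : weak_partial U ord0 v g.
Let V : 'rV[R]_n.+1 -> R := v \_ K.
Let W : 'rV[R]_n.+1 -> R := g \_ K.

Variable p : R.
Let a (x : 'rV[R]_n.+1) := `|V x| `^ p.
Let w (x : 'rV[R]_n.+1) := `|W x| `^ p.
Hypothesis aoo : (\int[mu]_x (a x)%:E < +oo)%E.
Hypothesis woo : (\int[mu]_x (w x)%:E < +oo)%E.

Variables (f : 'rV[R]_n.+1 -> R) (rho L M B : R).
Hypotheses (mf : measurable_fun setT f) (f01 : forall x, 0 <= f x <= 1).
Hypotheses (rho0 : 0 < rho) (L0 : 0 <= L) (B0 : 0 <= B).
Hypothesis fK : forall x, f x != 0 ->
  forall y : 'rV[R]_n.+1, (forall i, `|y 0 i - x 0 i| <= rho) ->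
  forall s, 0 <= s <= rho -> K (y + s *: e1).
Hypothesis fL : forall x s, `|f x - f (x - s *: e1)| <= L * `|s|.
Hypothesis fB : forall x, f x != 0 -> 0 <= x 0 ord0 + M <= B.

(** The function [phi] plays the role of [(x1 + M) w] in the formal computation. The
    bound [M2] exceeds [B] by 1 to cover [x1 + M - h] for steps [h <= 1]. *)
Let phi (x : 'rV[R]_n.+1) := (x 0 ord0 + M) * f x.
Let M2 := B + 1.
Let M20 : 0 < M2. Proof. by rewrite ltr_wpDl. Qed.

(** With this parameter the absorbed term is at most half of the left-hand side. *)
Let tau := (2 * M2)^-1.
Let tau0 : 0 < tau. Proof. by rewrite invr_gt0 mulr_gt0. Qed.

Let f0 x : 0 <= f x. Proof. by case/andP: (f01 x). Qed.
Let f1 x : f x <= 1. Proof. by case/andP: (f01 x). Qed.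
Let a0 x : 0 <= a x. Proof. exact: powR_ge0. Qed.
Let w0 x : 0 <= w x. Proof. exact: powR_ge0. Qed.

Let mV : measurable_fun setT V.
Proof.
have [lv _ _] := wvg.
by apply/measurable_EFinP; exact: measurable_int (L1loc_integrable oU cK KU lv).
Qed.
Let mW : measurable_fun setT W.
Proof.
have [_ lg _] := wvg.
by apply/measurable_EFinP; exact: measurable_int (L1loc_integrable oU cK KU lg).
Qed.

Let mpow (F : 'rV[R]_n.+1 -> R) : measurable_fun setT F ->
  measurable_fun setT (fun x => `|F x| `^ p).
Proof.
move=> mF; apply: (@measurableT_comp _ _ _ _ _ _ (@powR R ^~ p)); first exact: measurable_powR.
exact: measurableT_comp.
Qed.
Let ma : measurable_fun setT a. Proof. exact: mpow. Qed.
Let mw : measurable_fun setT w. Proof. exact: mpow. Qed.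

Let phi_ge0 x : 0 <= phi x.
Proof.
rewrite /phi; have [->|fx] := eqVneq (f x) 0; first by rewrite mulr0.
by rewrite mulr_ge0//; have /andP[] := fB fx.
Qed.

Let phi_le x : phi x <= M2 * f x.
Proof.
rewrite /phi; have [->|fx] := eqVneq (f x) 0; first by rewrite !mulr0.
by rewrite ler_wpM2r// /M2; have /andP[_ h2] := fB fx; lra.
Qed.

Let mphi : measurable_fun setT phi.
Proof.
apply: measurable_funM => //; apply: measurable_funD => //.
exact: measurable_rV_coord.
Qed.

Let J (F : 'rV[R]_n.+1 -> R) := (\int[mu]_x (F x)%:E)%E.

Let J_ge0 (F : 'rV[R]_n.+1 -> R) : (forall x, 0 <= F x) -> (0 <= J F)%E.
Proof. by move=> F0; apply: integral_ge0 => x _; rewrite lee_fin. Qed.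

Let JZ (c : R) (F : 'rV[R]_n.+1 -> R) : 0 <= c -> measurable_fun setT F -> (forall x, 0 <= F x) ->
  J (fun x => c * F x) = (c%:E * J F)%E.
Proof.
move=> c0 mF F0; rewrite /J -ge0_integralZl//; first exact/measurable_EFinP.
by move=> x _; rewrite lee_fin.
Qed.

Let JD (F1 F2 : 'rV[R]_n.+1 -> R) : measurable_fun setT F1 -> measurable_fun setT F2 ->
  (forall x, 0 <= F1 x) -> (forall x, 0 <= F2 x) ->
  J (fun x => F1 x + F2 x) = (J F1 + J F2)%E.
Proof.
move=> m1 m2 F10 F20; rewrite /J -ge0_integralD//;
  by [move=> x _; rewrite lee_fin|apply/measurable_EFinP].
Qed.

Let Jle (F1 F2 : 'rV[R]_n.+1 -> R) : measurable_fun setT F1 -> measurable_fun setT F2 ->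
  (forall x, 0 <= F1 x) -> (forall x, F1 x <= F2 x) -> (J F1 <= J F2)%E.
Proof.
move=> m1 m2 F10 F12; apply: ge0_le_integral => //.
- by move=> x _; rewrite lee_fin.
- exact/measurable_EFinP.
- exact/measurable_EFinP.
- by move=> x _; rewrite lee_fin.
Qed.

Let Jfin (F G : 'rV[R]_n.+1 -> R) (c : R) : measurable_fun setT F -> measurable_fun setT G ->
  (forall x, 0 <= F x) -> (forall x, 0 <= G x) -> 0 <= c ->
  (forall x, F x <= c * G x) -> (J G < +oo)%E -> J F \is a fin_num.
Proof.
move=> m1 m2 F10 F20 c0 F12 Goo; rewrite ge0_fin_numE; last exact: J_ge0.
apply: (@le_lt_trans _ _ (J (fun x => c * G x))).
  by apply: Jle => //; exact: measurable_funM.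
by rewrite JZ// lte_mul_pinfty// J_ge0.
Qed.

Section step.
Variables (C h : R).
Hypotheses (C0 : 0 <= C) (h0 : 0 < h) (hrho : h <= rho) (h1 : h <= 1).
Hypothesis HC : increment_bound p tau C.

Definition backward_quot (x : 'rV[R]_n.+1) := `|f x - f (x - h *: e1)| / h.

Let phih x := phi (x - h *: e1).
Let ah x := a (x + h *: e1).

Let mfh : measurable_fun setT (fun x : 'rV[R]_n.+1 => f (x - h *: e1)).
Proof. exact: (measurable_fun_shift (- (h *: e1))). Qed.

Lemma measurable_backward_quot : measurable_fun setT backward_quot.
Proof.
apply: measurable_funM => //; apply: measurableT_comp => //.
exact: measurable_funB.
Qed.

Lemma backward_quot_ge0 x : 0 <= backward_quot x. Proof. by rewrite divr_ge0// ltW. Qed.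

Lemma backward_quot_le x : backward_quot x <= L.
Proof.
by rewrite ler_pdivrMr//; apply: le_trans (fL _ _) _; rewrite gtr0_norm.
Qed.

Let mphih : measurable_fun setT phih.
Proof. exact: (measurable_fun_shift (- (h *: e1))). Qed.

(** A discrete product rule: the difference of [phi] at step [h] is [h f x], which
    produces the left-hand side, plus the difference of [f] with a bounded factor. *)
Let stepI x : h * f x + phih x <= phi x + M2 * (h * backward_quot x).
Proof.
rewrite -lerBlDl.
have -> : h * f x + phih x - phi x =
    (x 0 ord0 + M - h) * (f (x - h *: e1) - f x).
  by rewrite /phih /phi !mxE !eqxx mulr1; ring.
have -> : h * backward_quot x = `|f (x - h *: e1) - f x|.
  by rewrite /backward_quot mulrC mulfVK ?gt_eqF// distrC.
apply: le_trans (ler_norm _) _; rewrite normrM.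
move: (h0) (h1) (B0) => h0' h1' B0'.
have [fx|fx] := eqVneq (f x) 0; last first.
  rewrite ler_wpM2r// ler_norml /M2; have /andP[? ?] := fB fx.
  by apply/andP; split; lra.
have [fh|fh] := eqVneq (f (x - h *: e1)) 0.
  by rewrite fh fx subr0 normr0 !mulr0.
rewrite ler_wpM2r// ler_norml /M2; have := fB fh; rewrite !mxE !eqxx mulr1.
by move=> /andP[? ?]; apply/andP; split; lra.
Qed.

Let intI : (h%:E * J (a \* f)%R + J (a \* phih)%R <=
  J (a \* phi)%R + (M2 * h)%:E * J (a \* backward_quot)%R)%E.
Proof.
have mq := measurable_backward_quot.
have m1 : measurable_fun setT (a \* f) by exact: measurable_funM.
have m2 : measurable_fun setT (a \* phih) by exact: measurable_funM.
have m3 : measurable_fun setT (a \* phi) by exact: measurable_funM.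
have m4 : measurable_fun setT (a \* backward_quot) by exact: measurable_funM.
have Mh : 0 <= M2 * h by rewrite mulr_ge0 ?ltW.
have hh : 0 <= h by exact: ltW.
have q0 := backward_quot_ge0.
have z1 x : 0 <= (a \* f) x by rewrite mulr_ge0.
have z2 x : 0 <= (a \* phih) x by rewrite mulr_ge0 ?phi_ge0.
have z3 x : 0 <= (a \* phi) x by rewrite mulr_ge0 ?phi_ge0.
have z4 x : 0 <= (a \* backward_quot) x by rewrite mulr_ge0.
have n1 : measurable_fun setT (fun x => h * (a \* f) x) by exact: measurable_funM.
have n4 : measurable_fun setT (fun x => (M2 * h) * (a \* backward_quot) x).
  exact: measurable_funM.
have y1 x : 0 <= h * (a \* f) x by rewrite mulr_ge0.
have y4 x : 0 <= (M2 * h) * (a \* backward_quot) x by rewrite mulr_ge0.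
rewrite -(JZ hh m1 z1) -(JZ Mh m4 z4) -(JD n1 m2 y1 z2) -(JD m3 n4 z3 y4).
apply: Jle.
- exact: measurable_funD.
- exact: measurable_funD.
- by move=> x; rewrite addr_ge0.
- move=> x; have H := ler_wpM2l (a0 x) (stepI x).
  have -> : h * (a \* f) x + (a \* phih) x = a x * (h * f x + phih x).
    by rewrite /=; ring.
  apply: (le_trans H); rewrite le_eqVlt; apply/orP; left; apply/eqP.
  by rewrite /=; ring.
Qed.

Let mah : measurable_fun setT ah.
Proof. exact: (measurable_fun_shift (h *: e1)). Qed.

Let ah0 x : 0 <= ah x. Proof. exact: a0. Qed.

(** The summation by parts: the shift passes from [phi] to [|v|^p]. *)
Let shiftI : J (a \* phih) = J (ah \* phi).
Proof.
rewrite /J -(@ge0_integral_shift _ _ (h *: e1) (fun x => ((a \* phih) x)%:E)).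
- by apply: eq_integral => x _; rewrite /= /phih addrK.
- by apply/measurable_EFinP; exact: measurable_funM.
- by move=> x; rewrite lee_fin mulr_ge0 ?phi_ge0.
Qed.

Let inner (x : 'rV[R]_n.+1) := (\int[leb]_(s in `[0%R, h]) (w (x + s *: e1))%:E)%E.

Let inner_ge0 x : (0 <= inner x)%E.
Proof. by apply: integral_ge0 => s _; rewrite lee_fin. Qed.

Let measurable_inner : measurable_fun setT inner.
Proof.
have mI : measurable (`[0, h]%classic : set (measurableTypeR R)) by exact: measurable_itv.
pose F (p : 'rV[R]_n.+1 * measurableTypeR R) : \bar R :=
  (\1_(`[0, h]%classic) p.2 * w (p.1 + p.2 *: e1))%:E.
have mF : measurable_fun setT F.
  apply/measurable_EFinP; apply: measurable_funM.
    apply: (measurableT_comp (measurable_indic mI)); exact: measurable_snd.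
  exact: (measurableT_comp mw (@measurable_slideD R n)).
have F0 q : (0 <= F q)%E by rewrite lee_fin mulr_ge0.
rewrite (_ : inner = fun x => \int[leb]_s F (x, s))%E.
  exact: (@measurable_fun_fubini_tonelli_F _ _ _ _ _ leb F mF F0).
by apply/funext => x; rewrite /inner integral_restrict_mul.
Qed.

Let T := (\int[mu]_x ((phi x)%:E * inner x))%E.

Let T_ge0 : (0 <= T)%E.
Proof. by apply: integral_ge0 => x _; rewrite mule_ge0// lee_fin phi_ge0. Qed.

(** [increment_bound] along almost every segment, multiplied by [phi] and
    integrated. *)
Let aeI : (J (a \* phi)%R <=
  J (ah \* phi)%R + (h * tau)%:E * J (a \* phi)%R + C%:E * T)%E.
Proof.
have m1 : measurable_fun setT (a \* phi) by exact: measurable_funM.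
have m2 : measurable_fun setT (ah \* phi) by exact: measurable_funM.
have z1 x : 0 <= (a \* phi) x by rewrite mulr_ge0 ?phi_ge0.
have z2 x : 0 <= (ah \* phi) x by rewrite mulr_ge0 ?phi_ge0.
have ht0 : 0 <= h * tau by rewrite mulr_ge0 ?ltW.
have y1 x : 0 <= h * tau * (a \* phi) x by rewrite mulr_ge0.
have n1 : measurable_fun setT (fun x => h * tau * (a \* phi) x) by exact: measurable_funM.
have mT : measurable_fun setT (fun x => (phi x)%:E * inner x)%E.
  by apply: emeasurable_funM => //; exact/measurable_EFinP.
have T0 x : (0 <= (phi x)%:E * inner x)%E by rewrite mule_ge0// lee_fin phi_ge0.
rewrite -(JZ ht0 m1 z1) -(JD m2 n1 z2 y1) /T -ge0_integralZl//.
rewrite /J -ge0_integralD//; last 4 first.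
- by move=> x _; rewrite lee_fin addr_ge0.
- by apply/measurable_EFinP; exact: measurable_funD.
- by move=> x _; rewrite mule_ge0.
- by apply: emeasurable_funM.
apply: ae_ge0_le_integral => //.
- by move=> x _; rewrite lee_fin.
- exact/measurable_EFinP.
- by move=> x _; rewrite adde_ge0 ?lee_fin ?addr_ge0// mule_ge0.
- apply: emeasurable_funD; first by apply/measurable_EFinP; exact: measurable_funD.
  by apply: emeasurable_funM.
have fKh x : [set x | f x != 0] x -> forall y : 'rV[R]_n.+1,
    (forall i, `|y 0 i - x 0 i| <= rho) -> forall s, 0 <= s <= h -> K (y + s *: e1).
  move=> fx y yx s /andP[s0 sh]; apply: (fK fx yx).
  by rewrite s0 (le_trans sh).
have := ae_difference oU cK KU wvg h0 rho0 fKh.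
apply: filterS => x xE _.
have [px|px] := eqVneq (phi x) 0.
  by rewrite /= px mul0e mule0 adde0 lee_fin !mulr0 addr0.
have fx : f x != 0 by apply: contra_neq px => fx; rewrite /phi fx mulr0.
have mWx := measurable_line x mW.
have H := HC h0 mWx (xE fx).
have := lee_wpmul2l (_ : 0 <= (phi x)%:E)%E H; rewrite lee_fin => /(_ (phi_ge0 x)).
rewrite -EFinM mulrC => /le_trans; apply.
rewrite ge0_muleDr; last 2 first.
- by rewrite -EFinD lee_fin addr_ge0 ?powR_ge0// !mulr_ge0 ?powR_ge0// ltW.
- by apply: mule_ge0; [rewrite lee_fin|exact: (inner_ge0 x)].
rewrite muleCA -EFinD -EFinM leeD// lee_fin.
by rewrite le_eqVlt; apply/orP; left; apply/eqP; rewrite /= /ah /a; ring.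
Qed.

(** After exchanging the integrals and translating, the integrand is [phi] at a shift
    of length at most [h], which the Lipschitz bound compares with [f]. *)
Let TI : (T <= (h * M2)%:E * (J (f \* w)%R + (L * h)%:E * J w))%E.
Proof.
rewrite /T tonelli_slide//.
have m1 : measurable_fun setT (f \* w) by exact: measurable_funM.
have z1 x : 0 <= (f \* w) x by rewrite mulr_ge0 ?w0.
have Lh0 : 0 <= L * h by rewrite mulr_ge0// ltW.
have M20' : 0 <= M2 by exact: ltW.
have n1 : measurable_fun setT (fun x => L * h * w x) by exact: measurable_funM.
have y1 x : 0 <= L * h * w x by rewrite mulr_ge0.
pose b := (M2%:E * (J (f \* w)%R + (L * h)%:E * J w))%E.
have bE : b = J (fun x => M2 * ((f \* w) x + L * h * w x)).
  rewrite JZ//; first by rewrite JD// JZ.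
  - exact: measurable_funD.
  - by move=> x; rewrite addr_ge0.
have -> : ((h * M2)%:E * (J (f \* w)%R + (L * h)%:E * J w) =
    \int[leb]_(s in `[0%R, h]) b)%E.
  rewrite integral_cst//=.
  by rewrite lebesgue_measure_itv/= lte_fin h0 -EFinB subr0 /b [RHS]muleC muleA -EFinM.
apply: ge0_le_integral => //.
- by move=> s _; apply: integral_ge0 => x _; rewrite lee_fin mulr_ge0 ?phi_ge0.
- apply: measurable_funTS.
  pose F (q : 'rV[R]_n.+1 * measurableTypeR R) : \bar R :=
    (phi (q.1 - q.2 *: e1) * w q.1)%:E.
  apply: (@measurable_fun_fubini_tonelli_G _ _ _ _ _ mu F).
    apply/measurable_EFinP; apply: measurable_funM.
      exact: (measurableT_comp mphi (@measurable_slideB R n)).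
    exact: (measurableT_comp mw measurable_fst).
  by move=> q; rewrite lee_fin mulr_ge0 ?phi_ge0.
- move=> s; rewrite /= in_itv/= => /andP[s0 sh]; rewrite bE; apply: Jle.
  + apply: measurable_funM => //.
    exact: (measurable_fun_shift (- (s *: e1))).
  + by apply: measurable_funM => //; exact: measurable_funD.
  + by move=> x; rewrite mulr_ge0 ?phi_ge0.
  + move=> x; apply: (@le_trans _ _ (M2 * f (x - s *: e1) * w x)).
      by rewrite ler_wpM2r.
    have -> : (f \* w) x + L * h * w x = (f x + L * h) * w x by rewrite /=; ring.
    rewrite -mulrA ler_wpM2l// ler_wpM2r//.
    have := fL x s; rewrite ler_norml lerBrDr => /andP[+ _] => H.
    have H2 : L * `|s| <= L * h by rewrite ler_wpM2l// ger0_norm.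
    lra.
Qed.

(** In terms of the finite numbers
    [x = J (a f)], [y = J (a phih)], [z = J (a phi)], [q = J (a backward_quot)] and
    the gradient integral [t], the previous facts read [h x + y <= z + M2 h q] and
    [z <= y + h tau z + C t]. The terms in [y] cancel, and [tau z <= x / 2]. *)
Lemma step_inequality : (J (a \* f)%R <=
  (2 * C * M2)%:E * (J (f \* w)%R + (L * h)%:E * J w) +
  (2 * M2)%:E * J (a \* backward_quot)%R)%E.
Proof.
have mq := measurable_backward_quot; have q0 := backward_quot_ge0.
have M20' : 0 <= M2 by exact: ltW.
have mX : measurable_fun setT (a \* f) by exact: measurable_funM.
have mZ : measurable_fun setT (a \* phi) by exact: measurable_funM.
have mY : measurable_fun setT (a \* phih) by exact: measurable_funM.
have mQ : measurable_fun setT (a \* backward_quot) by exact: measurable_funM.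
have mP : measurable_fun setT (f \* w) by exact: measurable_funM.
have X0 x : 0 <= (a \* f) x by rewrite mulr_ge0.
have Z0 x : 0 <= (a \* phi) x by rewrite mulr_ge0 ?phi_ge0.
have Y0 x : 0 <= (a \* phih) x by rewrite mulr_ge0 ?phi_ge0.
have Q0 x : 0 <= (a \* backward_quot) x by rewrite mulr_ge0.
have P0 x : 0 <= (f \* w) x by rewrite mulr_ge0.
have phiM x : phi x <= M2 by apply: le_trans (phi_le x) _; rewrite ler_piMr.
have X : J (a \* f) \is a fin_num.
  refine (Jfin mX ma X0 a0 ler01 _ aoo) => x.
  by rewrite /= mul1r ler_piMr.
have Z : J (a \* phi) \is a fin_num.
  refine (Jfin mZ ma Z0 a0 M20' _ aoo) => x.
  by rewrite /= mulrC ler_wpM2r.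
have Y : J (a \* phih) \is a fin_num.
  refine (Jfin mY ma Y0 a0 M20' _ aoo) => x.
  by rewrite /= mulrC ler_wpM2r// phiM.
have Q : J (a \* backward_quot) \is a fin_num.
  refine (Jfin mQ ma Q0 a0 L0 _ aoo) => x.
  by rewrite /= mulrC ler_wpM2r// backward_quot_le.
have P : J (f \* w) \is a fin_num.
  refine (Jfin mP mw P0 w0 ler01 _ woo) => x.
  by rewrite /= ler_wpM2r.
have Wt : J w \is a fin_num by rewrite ge0_fin_numE; [exact: woo|exact: J_ge0].
have ZX : (J (a \* phi)%R <= M2%:E * J (a \* f)%R)%E.
  rewrite -(JZ M20' mX X0); apply: Jle => //.
  - exact: measurable_funM.
  - by move=> x; rewrite mulrCA ler_wpM2l.
have := aeI; rewrite -shiftI; have := TI; have := intI; move: ZX.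
have Tfin : T \is a fin_num.
  rewrite ge0_fin_numE; last exact: T_ge0.
  by apply: le_lt_trans TI _; rewrite -(fineK P) -(fineK Wt) -EFinM ltry.
rewrite -(fineK X) -(fineK Z) -(fineK Y) -(fineK Q) -(fineK P) -(fineK Wt) -(fineK Tfin).
rewrite -?EFinM -?EFinD -?EFinM -?EFinD !lee_fin.
set x := fine (J (a \* f)); set z := fine (J (a \* phi)); set y := fine (J (a \* phih)).
set q := fine (J (a \* backward_quot)); set b := fine (J (f \* w)); set d := fine (J w).
set t := fine T.
move=> zx hx tb zy.
have tM : tau * M2 = 2^-1 by rewrite /tau invfM mulfVK// gt_eqF.
have Ct : C * t <= C * (h * M2 * (b + L * h * d)) by rewrite ler_wpM2l.
have hz : h * tau * z <= h * tau * (M2 * x).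
  by rewrite ler_wpM2l// mulr_ge0 ?ltW.
have hz2 : h * tau * (M2 * x) = h * x / 2 by rewrite mulrA -(mulrA h) tM mulrAC.
have key : h * x <= h * (2 * C * M2 * (b + L * h * d) + 2 * M2 * q).
  have e1' : h * (2 * C * M2 * (b + L * h * d) + 2 * M2 * q) =
    2 * (C * (h * M2 * (b + L * h * d))) + 2 * (M2 * h * q) by ring.
  by rewrite e1'; lra.
by rewrite -(ler_pM2l h0).
Qed.

End step.

Section limit.
Variable C : R.
Hypothesis C0 : 0 <= C.
Hypothesis HC : increment_bound p tau C.
Variable r : 'rV[R]_n.+1 -> R.
Hypotheses (mr : measurable_fun setT r) (r0 : forall x, 0 <= r x).
(** The bound is one-sided and pointwise: [f] need not be differentiable. *)
Hypothesis backward_quot_r : forall x e, 0 < e ->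
  exists2 del, 0 < del & forall h, 0 < h < del -> backward_quot h x <= r x + e.

Let m := Num.min rho 1.
Let m0 : 0 < m. Proof. by rewrite lt_min rho0 ltr01. Qed.
Let hk (k : nat) := m * harmonic k.
Let hk0 k : 0 < hk k. Proof. by rewrite mulr_gt0// /harmonic/= invr_gt0. Qed.
Let hkm k : hk k <= m.
Proof. by rewrite ler_piMr ?(ltW m0)// /harmonic/= invf_le1// ler1n. Qed.
Let hk_cvg : hk k @[k --> \oo] --> (0 : R).
Proof. by rewrite -(mulr0 m); apply: cvgM; [exact: cvg_cst|exact: cvg_harmonic]. Qed.

(** The part of the difference quotient that exceeds [r]; unlike the quotient, it
    tends to 0 everywhere, so that dominated convergence applies. *)
Let excess k (x : 'rV[R]_n.+1) := Num.max (backward_quot (hk k) x - r x) 0.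

Let excess_ge0 k x : 0 <= excess k x. Proof. by rewrite le_max lexx orbT. Qed.

Let excess_le k x : excess k x <= L.
Proof.
rewrite ge_max L0 andbT; apply: (@le_trans _ _ (backward_quot (hk k) x)).
  by rewrite gerBl r0.
exact: backward_quot_le.
Qed.

Let measurable_excess k : measurable_fun setT (excess k).
Proof.
apply: measurable_maxr => //; apply: measurable_funB => //.
exact: measurable_backward_quot.
Qed.

Let excess_cvg x : excess k x @[k --> \oo] --> (0 : R).
Proof.
apply/cvgr0Pnorm_le => e e0; have [del del0 H] := backward_quot_r x e0; near=> k.
rewrite ger0_norm// ge_max (ltW e0) andbT lerBlDl.
apply: H; rewrite hk0/= -(gtr0_norm (hk0 _)); near: k.
by move/cvgr0Pnorm_lt : hk_cvg => /(_ _ del0).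
Unshelve. all: by end_near. Qed.

Let J_excess_cvg : J (a \* excess k)%R @[k --> \oo] --> 0%E.
Proof.
have ia : mu.-integrable setT (fun x => (L * a x)%:E).
  apply/integrableP; split; first by apply/measurable_EFinP; exact: measurable_funM.
  rewrite (eq_integral (fun x => (L * a x)%:E)); last first.
    by move=> x _; rewrite gee0_abs// lee_fin mulr_ge0.
  rewrite -/(J (fun x => L * a x)) (JZ L0 ma a0).
  by apply: lte_mul_pinfty; [rewrite lee_fin| |exact: aoo].
have [|||||_ _ ] := @dominated_convergence _ _ _ mu setT measurableT
   (fun k x => ((a \* excess k) x)%:E) (cst 0%E) (fun x => (L * a x)%:E).
- by move=> k; apply/measurable_EFinP; exact: measurable_funM.
- exact: measurable_cst.
- apply/aeW => x _; apply: cvg_EFin; first exact: nearW.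
  by rewrite -(mulr0 (a x)); apply: cvgM; [exact: cvg_cst|exact: excess_cvg].
- exact: ia.
- apply/aeW => x k _; rewrite gee0_abs ?lee_fin ?mulr_ge0//.
  by rewrite /= mulrC ler_wpM2r.
- by rewrite integral_cst// mul0e.
Qed.

Lemma limit_inequality :
  (J (a \* f)%R <= (2 * C * M2)%:E * J (f \* w)%R + (2 * M2)%:E * J (a \* r)%R)%E.
Proof.
have M22 : 0 < 2 * M2 by rewrite mulr_gt0.
have CM : 0 <= 2 * C * M2 by rewrite !mulr_ge0// ltW.
have mX : measurable_fun setT (a \* f) by exact: measurable_funM.
have mP : measurable_fun setT (f \* w) by exact: measurable_funM.
have mR : measurable_fun setT (a \* r) by exact: measurable_funM.
have X0 x : 0 <= (a \* f) x by rewrite mulr_ge0.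
have P0 x : 0 <= (f \* w) x by rewrite mulr_ge0.
have R0 x : 0 <= (a \* r) x by rewrite mulr_ge0.
have mE k : measurable_fun setT (a \* excess k) by exact: measurable_funM.
have E0 k x : 0 <= (a \* excess k) x by rewrite mulr_ge0.
have X : J (a \* f) \is a fin_num.
  refine (Jfin mX ma X0 a0 ler01 _ aoo) => x.
  by rewrite /= mul1r ler_piMr.
have P : J (f \* w) \is a fin_num.
  refine (Jfin mP mw P0 w0 ler01 _ woo) => x.
  by rewrite /= ler_wpM2r.
have E k : J (a \* excess k) \is a fin_num.
  refine (Jfin (mE k) ma (E0 k) a0 L0 _ aoo) => x.
  by rewrite /= mulrC ler_wpM2r.
have Wt : J w \is a fin_num by rewrite ge0_fin_numE; [exact: woo|exact: J_ge0].
have [Roo|Roo] := eqVneq (J (a \* r)) +oo%E.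
  by rewrite Roo gt0_muley ?lte_fin// addey ?leey// -(fineK P) -EFinM.
have Rf : J (a \* r) \is a fin_num by rewrite ge0_fin_numE ?ltey// J_ge0.
have Ek : fine (J (a \* excess k)) @[k --> \oo] --> (0 : R).
  by apply: fine_cvg; exact: J_excess_cvg.
rewrite -(fineK X) -(fineK P) -(fineK Rf) -!EFinM -EFinD lee_fin.
set x := fine (J (a \* f)); set b := fine (J (f \* w)); set c := fine (J (a \* r)).
pose d := fine (J w).
pose err k := 2 * C * M2 * (L * hk k * d) + 2 * M2 * fine (J (a \* excess k)).
have errc : err k @[k --> \oo] --> (0 : R).
  rewrite -[X in _ --> X](_ : 2 * C * M2 * (L * 0 * d) + 2 * M2 * 0 = _); last by ring.
  apply: cvgD; apply: cvgM; try exact: cvg_cst; last exact: Ek.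
  by apply: cvgM; [apply: cvgM; [exact: cvg_cst|exact: hk_cvg]|exact: cvg_cst].
have step k : x <= 2 * C * M2 * b + 2 * M2 * c + err k.
  have hr : hk k <= rho by apply: le_trans (hkm k) _; rewrite ge_min lexx.
  have h1 : hk k <= 1 by apply: le_trans (hkm k) _; rewrite ge_min lexx orbT.
  have := step_inequality C0 (hk0 k) hr h1 HC.
  have : (J (a \* backward_quot (hk k))%R <= J (a \* r)%R + J (a \* excess k)%R)%E.
    rewrite -(JD mR (mE k) R0 (E0 k)); apply: Jle.
    - by apply: measurable_funM => //; exact: measurable_backward_quot.
    - exact: measurable_funD.
    - by move=> y; rewrite mulr_ge0// backward_quot_ge0.
    - by move=> y; rewrite /= -mulrDr ler_wpM2l// addrC -lerBlDr le_max lexx.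
  have Q : J (a \* backward_quot (hk k)) \is a fin_num.
    refine (Jfin _ ma _ a0 L0 _ aoo).
    - by apply: measurable_funM => //; exact: measurable_backward_quot.
    - by move=> y; rewrite mulr_ge0// backward_quot_ge0.
    - by move=> y; rewrite /= mulrC ler_wpM2r// backward_quot_le.
  rewrite -(fineK X) -(fineK P) -(fineK Rf) -(fineK (E k)) -(fineK Q) -(fineK Wt).
  rewrite -?EFinM -?EFinD -?EFinM -?EFinD !lee_fin.
  rewrite -/x -/b -/c -/d /err.
  set e := fine (J (a \* excess k)); set q := fine (J (a \* backward_quot (hk k))).
  move=> qe xq; have q2 : 2 * M2 * q <= 2 * M2 * (c + e) by rewrite ler_wpM2l// ltW.
  by move: xq q2; rewrite !mulrDr; lra.
have cc : (2 * C * M2 * b + 2 * M2 * c + err k) @[k --> \oo] -->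
    2 * C * M2 * b + 2 * M2 * c + 0.
  by apply: cvgD => //; exact: cvg_cst.
rewrite addr0 in cc.
by apply: (cvgr_to_ge cc); exact: nearW.
Qed.

End limit.

End core.

(** * Euclidean norm and distance functions *)

Section euclid.
Variables (R : realType) (n : nat).
Implicit Types (x y z : 'rV[R]_n.+1) (A D : set 'rV[R]_n.+1).

Lemma enorm_ge0 x : 0 <= enorm x. Proof. exact: sqrtr_ge0. Qed.

Lemma sqr_enorm x : enorm x ^+ 2 = \sum_i x 0 i ^+ 2.
Proof. by rewrite sqr_sqrtr// sumr_ge0// => i _; exact: sqr_ge0. Qed.

Lemma normr_coord_le_enorm x i : `|x 0 i| <= enorm x.
Proof.
rewrite -(@ler_pXn2r _ 2)// ?nnegrE ?enorm_ge0// sqr_enorm real_normK ?num_real//.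
by rewrite (bigD1 i)//= lerDl sumr_ge0// => j _; exact: sqr_ge0.
Qed.

Lemma enorm0_eq0 x : enorm x = 0 -> x = 0.
Proof.
move=> x0; apply/rowP => i; apply/eqP; rewrite mxE -normr_eq0.
by rewrite eq_le normr_ge0 andbT -x0 normr_coord_le_enorm.
Qed.

Lemma enorm0 : enorm (0 : 'rV[R]_n.+1) = 0.
Proof. by rewrite /enorm big1 ?sqrtr0// => i _; rewrite mxE expr0n. Qed.

Lemma enormN x : enorm (- x) = enorm x.
Proof. by congr Num.sqrt; apply: eq_bigr => i _; rewrite mxE sqrrN. Qed.

(** Summing
    [2 x_i y_i <= (b / a) x_i^2 + (a / b) y_i^2] with [a] and [b] the norms of [x]
    and [y] gives the Cauchy-Schwarz inequality. *)
Lemma ler_enormD x y : enorm (x + y) <= enorm x + enorm y.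
Proof.
have [/enorm0_eq0 ->|x0] := eqVneq (enorm x) 0; first by rewrite enorm0 !add0r.
have [/enorm0_eq0 ->|y0] := eqVneq (enorm y) 0; first by rewrite enorm0 !addr0.
set a := enorm x; set b := enorm y.
have a0 : 0 < a by rewrite lt_neqAle eq_sym x0 enorm_ge0.
have b0 : 0 < b by rewrite lt_neqAle eq_sym y0 enorm_ge0.
rewrite -(@ler_pXn2r _ 2)// ?nnegrE ?addr_ge0 ?enorm_ge0// sqr_enorm.
apply: (@le_trans _ _ (\sum_i ((1 + b / a) * x 0 i ^+ 2 + (1 + a / b) * y 0 i ^+ 2))).
  apply: ler_sum => i _; rewrite mxE -subr_ge0.
  have -> : (1 + b / a) * x 0 i ^+ 2 + (1 + a / b) * y 0 i ^+ 2 - (x 0 i + y 0 i) ^+ 2 =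
     (b * x 0 i - a * y 0 i) ^+ 2 / (a * b) by field; rewrite !gt_eqF.
  by rewrite divr_ge0 ?sqr_ge0// mulr_ge0 ?ltW.
rewrite big_split/= -!mulr_sumr -!sqr_enorm -/a -/b le_eqVlt; apply/orP; left.
by apply/eqP; field; rewrite !gt_eqF.
Qed.

Lemma enorm_e1 (s : R) : enorm (s *: e1 : 'rV[R]_n.+1) = `|s|.
Proof.
rewrite /enorm big_ord_recl big1 => [|i _]; last by rewrite !mxE/= mulr0 expr0n.
by rewrite addr0 !mxE !eqxx mulr1 sqrtr_sqr.
Qed.

Lemma enorm_le_coord x (e : R) : (forall i, `|x 0 i| <= e) -> enorm x <= n.+1%:R * e.
Proof.
move=> xe; have e0 : 0 <= e by apply: le_trans (xe ord0).
rewrite -(@ler_pXn2r _ 2)// ?nnegrE ?enorm_ge0 ?mulr_ge0// sqr_enorm.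
apply: (@le_trans _ _ (\sum_(i < n.+1) e ^+ 2)).
  apply: ler_sum => i _; rewrite -real_normK ?num_real//.
  by apply: lerXn2r; rewrite ?nnegrE.
rewrite sumr_const card_ord -[e ^+ 2 *+ _]mulr_natl exprMn ler_wpM2r ?sqr_ge0//.
by rewrite -natrX ler_nat leq_pmulr.
Qed.

Lemma continuous_enorm_lipschitz (f : 'rV[R]_n.+1 -> R) (L : R) : 0 <= L ->
  (forall x y, `|f x - f y| <= L * enorm (x - y)) -> continuous f.
Proof.
move=> L0 fL x A /= /(nbhs_ballP (f x))[e /= e0 eA].
have d0 : 0 < e / ((L + 1) * n.+1%:R).
  by rewrite divr_gt0// mulr_gt0// ltr_wpDl.
apply/nbhs_ballP; exists (e / ((L + 1) * n.+1%:R)) => //= y.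
rewrite rV_ball_coord// => xy; apply: eA => /=; apply: (le_lt_trans (fL x y)).
have h : forall i, `|(x - y) 0 i| <= e / ((L + 1) * n.+1%:R).
  by move=> i; rewrite !mxE; apply: ltW; exact: xy.
apply: le_lt_trans (ler_wpM2l L0 (enorm_le_coord h)) _.
rewrite (_ : n.+1%:R * _ = e / (L + 1)); last first.
  have L1 : L + 1 != 0 by rewrite gt_eqF// ltr_wpDl.
  have : n.+1%:R != 0 :> R by rewrite pnatr_eq0.
  by move: (n.+1%:R) => N N0; field; rewrite N0 L1.
by rewrite mulrCA gtr_pMr// ltr_pdivrMr ?mul1r ?ltrDl// ltr_wpDl.
Qed.

Lemma dist_le x y A : A y -> dist x A <= enorm (x - y).
Proof.
by move=> Ay; apply: ge_inf; [exists 0 => _ [z _ <-]; exact: enorm_ge0|exists y].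
Qed.

Lemma dist_ge0 x A : A !=set0 -> 0 <= dist x A.
Proof.
move=> [y Ay]; apply: lb_le_inf; first by exists (enorm (x - y)), y.
by move=> _ [z _ <-]; exact: enorm_ge0.
Qed.

Lemma dist_eq0 x A : A x -> dist x A = 0.
Proof.
move=> Ax; apply/eqP; rewrite eq_le dist_ge0 ?andbT; last by exists x.
by have := dist_le x Ax; rewrite subrr enorm0.
Qed.

Lemma dist_lipschitz x y A : A !=set0 -> `|dist x A - dist y A| <= enorm (x - y).
Proof.
move=> A0.
have key u v : dist u A <= dist v A + enorm (u - v).
  rewrite -lerBlDr; apply: lb_le_inf; first by case: A0 => z Az; exists (enorm (v - z)), z.
  move=> _ [z Az <-]; rewrite lerBlDr; apply: le_trans (dist_le u Az) _.
  by rewrite [leRHS]addrC (_ : u - z = (u - v) + (v - z)) ?ler_enormD// addrA subrK.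
rewrite ler_norml lerBlDl key andbT lerBrDr addrC lerBlDr.
by have := key y x; rewrite -opprB enormN.
Qed.

Lemma sdist_lipschitz D x y : D !=set0 -> ~` D !=set0 ->
  `|sdist D x - sdist D y| <= 2 * enorm (x - y).
Proof.
move=> D0 C0; rewrite /sdist.
have -> : dist x D - dist x (~` D) - (dist y D - dist y (~` D)) =
  (dist x D - dist y D) - (dist x (~` D) - dist y (~` D)) by ring.
apply: le_trans (ler_normB _ _) _.
by rewrite mulr2n mulrDl mul1r lerD// dist_lipschitz.
Qed.

(** Outside [D] the signed distance is the distance to [D]. This bounds the
    sublevel sets independently of the level. *)
Lemma sublevel_near D (t : R) x : D !=set0 -> 0 < t -> sublevel D t x ->
  exists2 y, D y & enorm (x - y) < t.
Proof.
move=> D0 t0; rewrite /sublevel/= /sdist.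
have [Dx _|Dx] := pselect (D x); first by exists x => //; rewrite subrr enorm0.
have ne : [set enorm (x - y) | y in D] !=set0.
  by case: D0 => y Dy; exists (enorm (x - y)), y.
rewrite (dist_eq0 (A := ~` D))// subr0 => /(inf_lt ne).
by move=> [_ [y Dy <-] yt]; exists y.
Qed.

End euclid.

(** * The weight *)

Section profile.
Variables (R : realType) (S : R -> R).
Hypothesis HS : transition_profile S.

Lemma profile_ge1 t : 1 <= t -> S t = 1.
Proof.
move=> t1; have [_ H _ _ _] := HS; have t0 : 0 < t by lra.
by rewrite H gtr0_norm// divff// gt_eqF.
Qed.

Lemma profile_leN1 t : t <= -1 -> S t = -1.
Proof.
move=> t1; have [_ _ _ SN _] := HS.
by rewrite -[t]opprK SN profile_ge1// lerNr.
Qed.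

(** The lower power bound in the definition of a profile is what keeps [S] away from
    -1 here. *)
Lemma profile_gtN1 t : -1 < t -> -1 < S t.
Proof.
move=> t1; have [h|h] := leP 1 t; first by rewrite profile_ge1//; lra.
have [_ _ _ _ [z1 [z2 [al [z10 _ _ H]]]]] := HS.
have t2 : 0 < t + 1 < 2 by apply/andP; split; lra.
have /andP[] := H _ t2; rewrite addrK => + _.
have : 0 < z1 * (t + 1) `^ al by rewrite mulr_gt0// powR_gt0//; case/andP: t2.
by move=> *; lra.
Qed.

Lemma profile_bounds t : -1 <= S t <= 1.
Proof.
have ge t' : -1 <= S t'.
  by have [/profile_leN1->//|/profile_gtN1/ltW] := leP t' (-1).
have [_ _ _ SN _] := HS.
by rewrite ge/=; have := ge (- t); rewrite SN; lra.
Qed.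

Lemma profile_lipschitz : exists2 LS, 0 <= LS & forall s t, `|S s - S t| <= LS * `|s - t|.
Proof.
have [[M [Mr H]] _ _ _ _] := HS.
exists (`|M| + 1); first by rewrite addr_ge0.
move=> s t; have := H (`|M| + 1) _ (s, t); apply => //=.
by rewrite (le_lt_trans (ler_norm M))// ltrDl.
Qed.

End profile.

Section weight_facts.
Variables (R : realType) (n : nat) (D : set 'rV[R]_n.+1) (S : R -> R) (eps eps0 : R).
Hypotheses (HS : transition_profile S) (D0 : D !=set0) (C0 : ~` D !=set0).
Hypotheses (Htub : tubular_radius D eps0) (eps_gt0 : 0 < eps) (eps_lt : eps < eps0).
Local Notation d := (sdist D).
Local Notation w := (weight S D eps).

Lemma sdist_continuous : continuous d.
Proof.
apply: (@continuous_enorm_lipschitz _ _ _ 2) => // x y; exact: sdist_lipschitz.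
Qed.

Lemma open_sublevel t : open (sublevel D t).
Proof.
rewrite (_ : sublevel D t = d @^-1` [set s | s < t])//.
by apply: open_comp; [move=> x _; exact: sdist_continuous|exact: open_lt].
Qed.

Lemma weight_lipschitz : exists2 L, 0 <= L & forall x y, `|w x - w y| <= L * enorm (x - y).
Proof.
have [LS LS0 HL] := profile_lipschitz HS.
exists (LS / eps); first by rewrite divr_ge0// ltW.
move=> x y; rewrite /weight.
have -> : 2^-1 * (1 + S (- d x / eps)) - 2^-1 * (1 + S (- d y / eps)) =
  2^-1 * (S (- d x / eps) - S (- d y / eps)) by ring.
rewrite normrM ger0_norm// ler_pdivrMl//.
apply: le_trans (HL _ _) _.
have -> : - d x / eps - - d y / eps = (d y - d x) / eps by ring.
rewrite normrM (gtr0_norm (x := eps^-1)) ?invr_gt0// distrC.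
have -> : 2 * (LS / eps * enorm (x - y)) = LS * (2 * enorm (x - y) * eps^-1) by ring.
rewrite ler_wpM2l// ler_wpM2r ?invr_ge0 ?(ltW eps_gt0)//.
exact: sdist_lipschitz.
Qed.

Lemma weight01 x : 0 <= w x <= 1.
Proof. by have /andP[] := profile_bounds HS (- d x / eps); rewrite /weight => *; apply/andP; split; lra. Qed.

Lemma weight_eq0 x : eps <= d x -> w x = 0.
Proof.
move=> h; rewrite /weight (profile_leN1 HS) ?subrr ?mulr0//.
by rewrite mulNr lerN2 ler_pdivlMr// mul1r.
Qed.

Lemma weight_eq1 x : d x <= - eps -> w x = 1.
Proof.
move=> h; rewrite /weight (profile_ge1 HS); first by lra.
by rewrite ler_pdivlMr// mul1r lerNr.
Qed.

Lemma weight_gt0 x : d x < eps -> 0 < w x.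
Proof.
move=> h; rewrite /weight mulr_gt0// -ltrBlDl sub0r (profile_gtN1 HS)//.
by rewrite mulNr ltrN2 ltr_pdivrMr// mul1r.
Qed.

Lemma sublevelE : sublevel D eps = [set x | 0 < w x].
Proof.
apply/seteqP; split => x /=; first exact: weight_gt0.
by rewrite /sublevel/=; apply: contraTlt => /weight_eq0 ->; rewrite ltxx.
Qed.

Lemma weight_continuous : continuous w.
Proof. by have [L L0] := weight_lipschitz; exact: continuous_enorm_lipschitz. Qed.

(** In the open layer of width [eps] both factors of the chain rule are available:
    the profile is differentiable on the open interval from -1 to 1, and the signed
    distance is differentiable throughout the tube. *)
Lemma weight_derivable x : - eps < d x < eps -> derivable w x e1.
Proof.
move=> /andP[dx1 dx2]; move: (eps_gt0) (eps_lt) => eps_gt0' eps_lt'.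
have xt : tube D (2 * eps0) x.
  have e2 : eps < 2 * eps0 by lra.
  split; first by rewrite /sublevel/=; lra.
  have : closure (sublevel D (- (2 * eps0))) `<=` [set y | d y <= - (2 * eps0)].
    have cl : closed [set y | d y <= - (2 * eps0)].
      rewrite (_ : mkset _ = d @^-1` [set s | s <= - (2 * eps0)])//.
      by apply: closed_comp; [move=> y _; exact: sdist_continuous|exact: closed_le].
    by rewrite [X in _ `<=` X](closure_id _).1//; apply: closureS => y; exact: ltW.
  by move=> H /H /=; lra.
have [_ [dd _] _] := Htub.
have /derivable1P dl : derivable d x e1 by apply: diff_derivable; exact: dd.
have [_ _ HS' _ _] := HS.
have Sx : derivable S (- d x / eps) 1.
  have : `|- d x / eps| < 1.
    by rewrite normrM normrN gtr0_norm ?invr_gt0// ltr_pdivrMr// mul1r ltr_norml dx1.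
  by move=> /HS' [].
apply/derivable1P; rewrite /weight.
have h1 := derivableP dl.
have h2 := @is_deriveZ _ _ _ _ (- eps^-1) _ _ _ h1.
have hS := derivableP Sx.
have E0 : (- eps^-1 \*: (fun h => d (h *: e1 + x))) 0 = - d x / eps.
  by rewrite /= scale0r add0r /GRing.scale/=; ring.
rewrite -E0 in hS.
have h3 := is_derive1_comp hS h2.
have h4 := is_deriveZ 2^-1 (is_deriveD (is_derive_cst (1 : R) (0 : R) (1 : R)) h3).
have [] := h4; rewrite (_ : 2^-1 \*: _ = fun h => 2^-1 * (1 + S (- d (h *: e1 + x) / eps)))//.
apply/funext => h.
by have -> : - d (h *: e1 + x) / eps = - eps^-1 * d (h *: e1 + x) by ring.
Qed.

End weight_facts.

(** * The inequality for the truncated weight *)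

Section nonneg_monotone.
Context d (T : measurableType d) (R : realType) (mu : {measure set T -> \bar R}).

(** The integral of a nonnegative function is a supremum over the simple functions
    below it, so it is monotone without measurability. It is used with the norm of the
    pointwise gradient of the weight on the right, about whose values at points of
    non-differentiability nothing is known. *)
Lemma ge0_le_integral_nonmeasurable (f g : T -> \bar R) :
  (forall x, 0 <= f x)%E -> (forall x, f x <= g x)%E ->
  (\int[mu]_x f x <= \int[mu]_x g x)%E.
Proof.
move=> f0 fg; rewrite !ge0_integralTE//; last by move=> x; exact: le_trans (f0 x) (fg x).
apply: ge_ereal_sup => _ [h/= hf <-]; apply: ereal_sup_ubound.
by exists h => // x; exact: le_trans (hf x) (fg x).
Qed.

End nonneg_monotone.

Section backward_quotient.
Variables (R : realType) (n : nat) (w : 'rV[R]_n.+1 -> R) (x : 'rV[R]_n.+1).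

Lemma derivable_backward (e : R) : derivable w x e1 -> 0 < e ->
  exists2 del, 0 < del & forall h, 0 < h < del ->
    `|(w x - w (x - h *: e1)) / h - partial ord0 w x| <= e.
Proof.
move=> dw e0.
have L : h^-1 *: (w (h *: e1 + x) - w x) @[h --> 0^'] --> partial ord0 w x := dw.
have /cvgrPdist_le/(_ _ e0) := L.
rewrite near_withinE => /nbhs_ballP[del /= del0 H].
exists del => // h /andP[h0 hd].
have := H (- h); rewrite /ball/= opprK add0r gtr0_norm// oppr_eq0 => /(_ hd (lt0r_neq0 h0)).
rewrite distrC scaleNr [- _ + x]addrC invrN /GRing.scale/= mulNr -mulrN opprB.
by rewrite mulrC.
Qed.

End backward_quotient.

Section truncation.
Variable R : realType.
Implicit Types (del s t : R).

(** The clamp of [s] to the interval from [del] to [1 - del], lowered so that it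
    starts at 0. *)
Definition trunc del s : R := Num.min s (1 - del) - Num.min s del.

Lemma trunc_ge0 del s : del <= 1 - del -> 0 <= trunc del s.
Proof.
by move=> h; rewrite /trunc; case: (leP s (1 - del)); case: (leP s del) => *; lra.
Qed.

Lemma trunc_le del s : 0 <= del -> 0 <= s -> trunc del s <= s.
Proof.
by move=> h s0; rewrite /trunc; case: (leP s (1 - del)); case: (leP s del) => *; lra.
Qed.

Lemma trunc_near del s : 0 <= del -> s <= 1 -> s - 2 * del <= trunc del s.
Proof.
by move=> h s0; rewrite /trunc; case: (leP s (1 - del)); case: (leP s del) => *; lra.
Qed.

Lemma trunc_eq0 del s : del <= 1 - del -> s <= del -> trunc del s = 0.
Proof.
by move=> h s0; rewrite /trunc; case: (leP s (1 - del)); case: (leP s del) => *; lra.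
Qed.

Lemma trunc_top del s : del <= 1 - del -> 1 - del <= s -> trunc del s = 1 - 2 * del.
Proof.
by move=> h s0; rewrite /trunc; case: (leP s (1 - del)); case: (leP s del) => *; lra.
Qed.

Lemma trunc_lipschitz del s t : del <= 1 - del -> `|trunc del s - trunc del t| <= `|s - t|.
Proof.
move=> h; have h1 := ler_norm (s - t); have h2 := ler_norm (t - s).
rewrite distrC in h2; rewrite /trunc ler_norml.
by case: (leP s (1 - del)); case: (leP s del); case: (leP t (1 - del));
  case: (leP t del) => *; apply/andP; split; lra.
Qed.

End truncation.

Section truncated_inequality.
Variables (R : realType) (n : nat) (D : set 'rV[R]_n.+1) (S : R -> R) (eps eps0 p : R).
Hypotheses (HS : transition_profile S) (D0 : D !=set0) (C0 : ~` D !=set0).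
Hypotheses (Htub : tubular_radius D eps0) (eps_gt0 : 0 < eps) (eps_lt : eps < eps0).
Hypothesis p1 : 1 <= p.
Local Notation mu := (lebesgue_rV R n.+1).
Local Notation d := (sdist D).
Local Notation w := (weight S D eps).
Local Notation U := (sublevel D eps).
Variable M : R.
Hypothesis M0 : 0 <= M.
Hypothesis UM : forall x, U x -> forall i, `|x 0 i| <= M.
Variables (v : 'rV[R]_n.+1 -> R) (G : 'rV[R]_n.+1 -> 'rV[R]_n.+1).
Hypothesis vG : sobolev U w p v G.

Local Notation r :=
  (fun x : 'rV[R]_n.+1 => if `|d x| < eps then `|partial ord0 w x| else 0).

Let oU : open U. Proof. exact: open_sublevel. Qed.
Let mU : measurable U. Proof. exact: open_rV_measurable. Qed.
Let mw : measurable_fun setT w.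
Proof. by apply: continuous_rV_measurable; exact: weight_continuous. Qed.
Let w0 x : 0 <= w x. Proof. by have /andP[] := weight01 D eps HS x. Qed.
Let w1 x : w x <= 1. Proof. by have /andP[] := weight01 D eps HS x. Qed.
Let U_w x : U x <-> 0 < w x.
Proof. by rewrite (sublevelE D HS eps_gt0). Qed.

Let derivable_w x : `|d x| < eps -> derivable w x e1.
Proof. by rewrite ltr_norml => dx; apply: (weight_derivable HS D0 C0 Htub). Qed.

(** Where the weight is differentiable, its partial derivative is a limit of
    difference quotients. *)
Lemma measurable_partial_weight : measurable_fun setT r.
Proof.
have cd := sdist_continuous D0 C0.
have md : measurable_fun setT (fun x => `|d x| < eps).
  apply: measurable_fun_ltr => //; apply: measurableT_comp => //.
  exact: continuous_rV_measurable.
pose q k (x : 'rV[R]_n.+1) : R := if `|d x| < eps then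
  `|(w x - w (x - harmonic k *: e1)) / harmonic k| else 0.
apply: (@measurable_fun_cvg _ _ _ _ q) => [k|x _].
  apply: measurable_fun_ifT => //; apply: measurableT_comp => //.
  apply: measurable_funM => //; apply: measurable_funB => //.
  exact: (measurable_fun_shift (- (harmonic k *: e1))).
rewrite /q; case: ifPn => dx; last exact: cvg_cst.
apply: cvg_norm; apply/cvgrPdist_le => e e0.
have [del del0 H] := derivable_backward (derivable_w dx) e0.
near=> k; rewrite distrC; apply: H.
have hk : 0 < harmonic k :> R by rewrite /harmonic/= invr_gt0.
rewrite hk andTb -(gtr0_norm hk); near: k.
by move/cvgr0Pnorm_lt : (@cvg_harmonic R) => /(_ _ del0).
Unshelve. all: by end_near. Qed.

Section fixed_del.
Variable del : R.
Hypotheses (del0 : 0 < del) (del2 : 2 * del < 1).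

Let del1 : del <= 1 - del. Proof. by move: (del2) => ?; lra. Qed.
Local Notation K := ([set x : 'rV[R]_n.+1 | del / 2 <= w x]).
Local Notation f := (fun x : 'rV[R]_n.+1 => trunc del (w x)).

Let KU : K `<=` U.
Proof. by move=> x /= h; apply/U_w; apply: lt_le_trans h; rewrite divr_gt0. Qed.

Let cK : compact K.
Proof.
apply: bounded_closed_compact.
  exists M; split; first exact: num_real.
  move=> y My x /KU /UM xM; apply: le_trans (ltW My).
  have -> : `|x| = \big[Num.max/0]_ij `|x ij.1 ij.2| by exact: mx_normrE.
  apply: bigmax_le => // -[i j] _ /=.
  by rewrite ord1.
rewrite (_ : K = w @^-1` [set s | del / 2 <= s])//.
apply: closed_comp; last exact: closed_ge.
by move=> x _; exact: weight_continuous.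
Qed.

Let f_neq0 x : f x != 0 -> del < w x.
Proof. by move=> fx; rewrite ltNge; apply: contra fx => h; rewrite trunc_eq0. Qed.

(** On [K] the weight is bounded below, so the weighted integrability becomes a plain
    one. *)
Lemma localized_power_lty u : in_Lp U w p u ->
  (\int[mu]_x (`|(u \_ K) x| `^ p)%:E < +oo)%E.
Proof.
move=> [mu_ uoo].
apply: (@le_lt_trans _ _ ((2 / del)%:E * Lp_normp U w p u)%E); last first.
  by apply: lte_mul_pinfty => //; rewrite lee_fin divr_ge0// ltW.
have mp : measurable_fun U (fun x => (`|u x| `^ p * w x)%:E).
  apply/measurable_EFinP; apply: measurable_funM; last exact: measurable_funTS.
  apply: (@measurableT_comp _ _ _ _ _ _ (@powR R ^~ p)); first exact: measurable_powR.
  exact: measurableT_comp.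
rewrite /Lp_normp -ge0_integralZl//; last 2 first.
- by move=> x _; rewrite lee_fin; apply: mulr_ge0; [exact: powR_ge0|exact: w0].
- by rewrite lee_fin divr_ge0// ltW.
rewrite [leRHS]integral_mkcond; apply: ge0_le_integral_nonmeasurable => x.
  by rewrite lee_fin powR_ge0.
rewrite !patchE; case: ifPn => [/set_mem xK|_].
  rewrite mem_set; last exact: KU.
  rewrite -EFinM lee_fin mulrCA ler_peMr ?powR_ge0//.
  by rewrite mulrAC ler_pdivlMr// mul1r -ler_pdivrMl// mulrC.
rewrite normr0 powR0; last by rewrite gt_eqF// (lt_le_trans ltr01).
case: ifPn => // _; rewrite -EFinM lee_fin.
apply: mulr_ge0; first by rewrite divr_ge0// ltW.
by apply: mulr_ge0; [exact: powR_ge0|exact: w0].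
Qed.

Let p_neq0 : p != 0.
Proof. by rewrite gt_eqF// (lt_le_trans ltr01). Qed.

Let f_ge0 x : 0 <= f x.
Proof. exact: trunc_ge0. Qed.

Let f_le x : f x <= w x.
Proof. by apply: trunc_le => //; exact: ltW. Qed.

Lemma localized_integral :
  (\int[mu]_x (`|(v \_ K) x| `^ p * f x)%:E =
    \int[mu]_(x in U) (`|v x| `^ p * f x)%:E)%E.
Proof.
rewrite [RHS]integral_mkcond; apply: eq_integral => x _; rewrite !patchE.
case: ifPn => [/set_mem xK|/negP xK]; first by rewrite mem_set//; exact: KU.
rewrite (_ : f x = 0) ?mulr0; first by case: ifPn.
apply: contra_notP xK => /eqP/f_neq0 h; rewrite inE/=.
by apply: le_trans (ltW h); move: (del0) => ?; lra.
Qed.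

Lemma gradient_term_le :
  (\int[mu]_x (f x * `|((fun x => G x 0 ord0) \_ K) x| `^ p)%:E <=
    Lp_normp U w p (fun x => enorm (G x)))%E.
Proof.
rewrite /Lp_normp [leRHS]integral_mkcond; apply: ge0_le_integral_nonmeasurable => x.
  by rewrite lee_fin; apply: mulr_ge0; [exact: f_ge0|exact: powR_ge0].
rewrite !patchE; case: ifPn => [/set_mem xK|_].
  rewrite mem_set; last exact: KU.
  rewrite lee_fin mulrC.
  apply: ler_pM; [exact: powR_ge0|exact: f_ge0| |exact: f_le].
  apply: ge0_ler_powR; [|by rewrite nnegrE|by rewrite nnegrE|].
    exact: le_trans ler01 p1.
  by rewrite [leRHS]ger0_norm ?enorm_ge0 ?normr_coord_le_enorm.
rewrite normr0 (powR0 p_neq0) mulr0; case: ifPn => // _.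
by rewrite lee_fin; apply: mulr_ge0; [exact: powR_ge0|exact: w0].
Qed.

Lemma boundary_term_le :
  (\int[mu]_x (`|(v \_ K) x| `^ p * r x)%:E <=
    \int[mu]_(x in U) (`|v x| `^ p * enorm (gradient w x))%:E)%E.
Proof.
rewrite [leRHS]integral_mkcond; apply: ge0_le_integral_nonmeasurable => x.
  by rewrite lee_fin; apply: mulr_ge0; [exact: powR_ge0|case: ifPn].
rewrite !patchE; case: ifPn => [/set_mem xK|_].
  rewrite mem_set; last exact: KU.
  rewrite lee_fin; apply: ler_wpM2l; first exact: powR_ge0.
  case: ifPn => _; last exact: enorm_ge0.
  by have := normr_coord_le_enorm (gradient w x) ord0; rewrite mxE.
rewrite normr0 (powR0 p_neq0) mul0r; case: ifPn => // _.
by rewrite lee_fin; apply: mulr_ge0; [exact: powR_ge0|exact: enorm_ge0].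
Qed.

(** Moving a point by at most [rho] in each coordinate and then by at most [rho]
    along [e1] changes the weight by at most [L (n + 2) rho <= del / 2]. *)
Lemma localized_step (L rho : R) : 0 <= L -> rho = del / (2 * (L + 1) * n.+2%:R) ->
  (forall x y, `|w x - w y| <= L * enorm (x - y)) ->
  forall x, f x != 0 -> forall y : 'rV[R]_n.+1, (forall i, `|y 0 i - x 0 i| <= rho) ->
  forall s, 0 <= s <= rho -> K (y + s *: e1).
Proof.
move=> L0 rhoE wL x /f_neq0 wx y yx s /andP[s0 srho].
have L10 : 0 < L + 1 by rewrite ltr_wpDl.
have : `|w x - w (y + s *: e1)| <= L * (n.+2%:R * rho).
  apply: le_trans (wL _ _) _; apply: ler_wpM2l; first exact: L0.
  rewrite -enormN opprB (_ : y + s *: e1 - x = (y - x) + s *: e1); last by rewrite addrAC.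
  apply: le_trans (ler_enormD _ _) _; rewrite enorm_e1 ger0_norm; last exact: s0.
  rewrite -[n.+2%:R]natr1 mulrDl mul1r; apply: lerD; last exact: srho.
  by apply: enorm_le_coord => i; rewrite !mxE.
have -> : L * (n.+2%:R * rho) = L / (L + 1) * (del / 2).
  have L1 := lt0r_neq0 L10; have : n.+2%:R != 0 :> R by rewrite pnatr_eq0.
  by rewrite rhoE; move: (n.+2%:R) => N N0; field; rewrite N0 L1.
have : L / (L + 1) * (del / 2) <= del / 2.
  apply: ler_piMl; first by rewrite divr_ge0 // ltW.
  by rewrite ltW// ltr_pdivrMr// mul1r ltrDl.
by rewrite /= ler_norml => h1 /andP[_ h2]; lra.
Qed.

Lemma localized_coord x : f x != 0 -> 0 <= x 0 ord0 + M <= 2 * M.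
Proof.
move=> /f_neq0 wx; have /UM/(_ ord0) : U x by apply/U_w; exact: lt_trans wx.
by rewrite ler_norml => /andP[? ?]; apply/andP; split; lra.
Qed.

(** In the open layer this is differentiability of the weight and the Lipschitz bound
    for [trunc]. Elsewhere the weight is 0 or 1 at [x], so that it stays below [del] or
    above [1 - del] nearby, where [trunc] is constant. *)
Lemma backward_quot_le_partial (L : R) : 0 <= L ->
  (forall x s, `|w x - w (x - s *: e1)| <= L * `|s|) ->
  forall x e, 0 < e -> exists2 eta, 0 < eta &
    forall h, 0 < h < eta -> backward_quot f h x <= r x + e.
Proof.
move=> L0 we1 x e e0; have L10 : 0 < L + 1 by rewrite ltr_wpDl.
have dL : 0 < del / (L + 1) by rewrite divr_gt0.
have small h : 0 < h < del / (L + 1) -> `|w x - w (x - h *: e1)| <= del.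
  move=> /andP[h0 hd]; apply: le_trans (we1 _ _) _; rewrite gtr0_norm//.
  apply: (@le_trans _ _ ((L + 1) * h)); first by rewrite ler_wpM2r ?ltW// ltrDl.
  by rewrite mulrC -ler_pdivlMr// ltW.
have [dx|dx] := ltP `|d x| eps.
  have [eta eta0 H] := derivable_backward (derivable_w dx) e0.
  exists eta => // h /[dup] /H {}H /andP[h0 _].
  apply: (@le_trans _ _ (`|(w x - w (x - h *: e1)) / h|)).
    rewrite /backward_quot normrM (gtr0_norm (x := h^-1)) ?invr_gt0//.
    by apply: ler_wpM2r; [rewrite invr_ge0 ltW|exact: trunc_lipschitz].
  by rewrite -lerBlDl; apply: le_trans H; rewrite lerB_dist.
exists (del / (L + 1)) => // h hd; rewrite /backward_quot.
suff -> : f x - f (x - h *: e1) = 0 by rewrite normr0 mul0r addr_ge0// ltW.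
have := small h hd; rewrite ler_norml => /andP[s1 s2].
move: dx; rewrite ler_normr => /orP[dx|dx].
  have wx := weight_eq0 HS eps_gt0 dx.
  rewrite wx in s1 s2 *; rewrite (trunc_eq0 del1 (ltW del0)) trunc_eq0 ?subrr//.
  by lra.
have wx : w x = 1 by apply: (weight_eq1 HS eps_gt0); rewrite lerNr.
rewrite wx in s1 s2 *; rewrite trunc_top ?gerBl ?(ltW del0)// trunc_top ?subrr//.
by lra.
Qed.

Lemma truncated_inequality C : 0 <= C ->
  increment_bound p (2 * (2 * M + 1))^-1 C ->
  (\int[mu]_(x in U) (`|v x| `^ p * trunc del (w x))%:E <=
   (2 * C * (2 * M + 1))%:E * Lp_normp U w p (fun x => enorm (G x)) +
   (2 * (2 * M + 1))%:E *
     \int[mu]_(x in U) (`|v x| `^ p * enorm (gradient w x))%:E)%E.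
Proof.
have [L L0 wL] := weight_lipschitz HS D0 C0 eps_gt0.
have rho0 : 0 < del / (2 * (L + 1) * n.+2%:R).
  by rewrite divr_gt0// !mulr_gt0// ltr_wpDl.
have we1 x s : `|w x - w (x - s *: e1)| <= L * `|s|.
  by apply: le_trans (wL _ _) _; rewrite opprB addrC subrK enorm_e1.
have mf : measurable_fun setT f.
  by apply: measurable_funB; apply: measurable_minr.
have f01 x : 0 <= f x <= 1.
  by apply/andP; split; [exact: f_ge0|exact: le_trans (f_le x) (w1 x)].
have fL x s : `|f x - f (x - s *: e1)| <= L * `|s|.
  by apply: le_trans (we1 x s); exact: trunc_lipschitz.
have r_ge0 x : 0 <= r x by case: ifPn.
have M2 : 0 <= 2 * M by rewrite mulr_ge0.
have [inv /(_ ord0)[wv inG]] := vG.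
move=> C_ge0 HC.
have := limit_inequality oU cK KU wv (localized_power_lty inv) (localized_power_lty inG)
  mf f01 rho0 L0 M2 (localized_step L0 erefl wL) fL localized_coord C_ge0 HC
  measurable_partial_weight r_ge0 (backward_quot_le_partial L0 we1).
rewrite -localized_integral => /le_trans; apply; apply: leeD.
  apply: lee_wpmul2l; last exact: gradient_term_le.
  by rewrite lee_fin; apply: mulr_ge0; [exact: mulr_ge0|exact: addr_ge0].
apply: lee_wpmul2l; last exact: boundary_term_le.
by rewrite lee_fin; apply: mulr_ge0; [exact: ler0n|exact: addr_ge0].
Qed.

End fixed_del.

End truncated_inequality.

(** * The theorem *)

Theorem corollary4p11 (R : realType) (n : nat) (D : set 'rV[R]_n.+1)
    (S : R -> R) (eps0 p : R) :
  bounded_C11_domain D -> tubular_radius D eps0 -> transition_profile S ->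
  1 <= p ->
  (forall eps, 0 <= eps <= eps0 -> connected (sublevel D eps)) ->
  exists CP : R, forall eps : R, 0 < eps < eps0 ->
    let Deps := sublevel D eps in
    let w := weight S D eps in
    forall (v : 'rV[R]_n.+1 -> R) (G : 'rV[R]_n.+1 -> 'rV[R]_n.+1),
      sobolev Deps w p v G ->
      (Lp_normp Deps w p v <=
       CP%:E * (Lp_normp Deps w p (fun x => enorm (G x)) +
                \int[lebesgue_rV R n.+1]_(x in Deps)
                  (`|v x| `^ p * enorm (gradient w x))%:E))%E.
Proof.
move=> [D0 _ _ [N [_ HN]] _] Htub HS p1 _.
have eps0_gt0 : 0 < eps0 by case: Htub.
pose M1 := `|N| + 1.
have DM x : D x -> forall i, `|x 0 i| <= M1.
  move=> Dx i; apply: (@le_trans _ _ `|x|); last first.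
    by apply: HN Dx; rewrite (le_lt_trans (ler_norm N))// ltrDl.
  have -> : `|x| = \big[Num.max/0]_ij `|x ij.1 ij.2| by exact: mx_normrE.
  by rewrite (le_bigmax _ (fun ij => `|x ij.1 ij.2|) (0, i)).
have M10 : 0 < M1 by rewrite ltr_wpDl.
have C0 : ~` D !=set0.
  (* A point far away: D is bounded. *)
  exists (const_mx (M1 + 1)) => /DM/(_ ord0); rewrite mxE gtr0_norm; last by rewrite addr_gt0.
  by rewrite gerDl ler10.
pose M := M1 + eps0.
have M0 : 0 <= M by rewrite addr_ge0// ltW.
pose B := 2 * M + 1.
have B0 : 0 < B by rewrite ltr_wpDl// mulr_ge0.
have tau0 : 0 < (2 * B)^-1 by rewrite invr_gt0 mulr_gt0.
have [C C_ge0 HC] := increment_bound_exists p1 tau0.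
exists (2 * C * B + 2 * B) => eps /andP[eps_gt0 eps_lt] U w v G vG.
have UM x : U x -> forall i, `|x 0 i| <= M.
  move=> /(sublevel_near D0 eps_gt0)[y Dy xy] i.
  rewrite -(subrK y x) mxE; apply: le_trans (ler_normD _ _) _.
  rewrite addrC lerD ?DM//; apply: le_trans (normr_coord_le_enorm _ _) _.
  by rewrite ltW// (lt_trans xy).
set P := Lp_normp U w p (fun x => enorm (G x)).
set Q := (X in (_ <= _ * (_ + X))%E).
have w0 x : 0 <= w x by have /andP[] := weight01 D eps HS x.
have w1 x : w x <= 1 by have /andP[] := weight01 D eps HS x.
have P0 : (0 <= P)%E.
  by apply: integral_ge0 => x _; rewrite lee_fin; apply: mulr_ge0; [exact: powR_ge0|exact: w0].
have Q0 : (0 <= Q)%E.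
  by apply: integral_ge0 => x _; rewrite lee_fin mulr_ge0 ?powR_ge0 ?enorm_ge0.
(* It suffices to keep the two constants separate. *)
apply: (@le_trans _ _ ((2 * C * B)%:E * P + (2 * B)%:E * Q)%E); last first.
  have cb0 : 0 <= 2 * C * B by rewrite !mulr_ge0// ltW.
  have b0 : 0 <= 2 * B by rewrite mulr_ge0// ltW.
  rewrite [X in (_ <= X)%E](_ : _ =
    (2 * C * B)%:E * (P + Q) + (2 * B)%:E * (P + Q))%E; last first.
    by rewrite -ge0_muleDl ?lee_fin.
  apply: leeD; apply: lee_wpmul2l; rewrite ?lee_fin//.
    exact: leeDl.
  exact: leeDr.
(* The shift by 2 ensures 2 * del k < 1. *)
pose del (k : nat) : R := harmonic (k + 2)%N.
have del0 k : 0 < del k by rewrite /del/harmonic/= invr_gt0.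
have del2 k : 2 * del k < 1.
  by rewrite /del/harmonic/= ltr_pdivrMr// mul1r ltr_nat addn2.
have step k : (\int[lebesgue_rV R n.+1]_(x in U) (`|v x| `^ p * trunc (del k) (w x))%:E <=
    (2 * C * B)%:E * P + (2 * B)%:E * Q)%E.
  exact: (truncated_inequality HS D0 C0 Htub eps_gt0 eps_lt p1 M0 UM vG (del0 k) (del2 k) C_ge0 HC).
have oU := open_sublevel D0 C0 (t := eps).
have mU : measurable U by exact: open_rV_measurable.
have mw : measurable_fun U w.
  by apply: measurable_funTS; apply: continuous_rV_measurable; exact: weight_continuous.
have [[mv voo] _] := vG.
have mvp : measurable_fun U (fun x => `|v x| `^ p).
  apply: (@measurableT_comp _ _ _ _ _ _ (@powR R ^~ p)); first exact: measurable_powR.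
  exact: measurableT_comp.
have tw k x : trunc (del k) (w x) <= w x by rewrite trunc_le// ltW.
have tw0 k x : 0 <= trunc (del k) (w x).
  by rewrite trunc_ge0//; have := del2 k => ?; lra.
have [|||||_ _ cvgT] := @dominated_convergence _ _ _ (lebesgue_rV R n.+1) U mU
   (fun k x => (`|v x| `^ p * trunc (del k) (w x))%:E)
   (fun x => (`|v x| `^ p * w x)%:E) (fun x => (`|v x| `^ p * w x)%:E).
- move=> k; apply/measurable_EFinP; apply: measurable_funM => //.
  by apply: measurable_funB; apply: measurable_minr.
- by apply/measurable_EFinP; apply: measurable_funM.
- apply/aeW => x _; apply: cvg_EFin; first exact: nearW.
  apply: cvgM; first exact: cvg_cst.
  have dc : del k @[k --> \oo] --> (0 : R).
    have := @cvg_harmonic R; rewrite -(cvg_shiftn 2); exact.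
  apply: (@squeeze_cvgr _ _ _ _ (fun k => w x - 2 * del k) (fun=> w x)).
  + by apply: nearW => k; rewrite tw andbT trunc_near// ltW.
  + rewrite -[X in _ --> X]subr0 -(mulr0 2); apply: cvgB; first exact: cvg_cst.
    by apply: cvgM => //; exact: cvg_cst.
  + exact: cvg_cst.
- apply/integrableP; split; first by apply/measurable_EFinP; exact: measurable_funM.
  rewrite (eq_integral (fun x => (`|v x| `^ p * w x)%:E)); first exact: voo.
  by move=> x _; rewrite gee0_abs// lee_fin; apply: mulr_ge0; [exact: powR_ge0|exact: w0].
- apply/aeW => x k _; rewrite gee0_abs ?lee_fin.
    by rewrite ler_wpM2l ?powR_ge0.
  by rewrite mulr_ge0 ?powR_ge0.
apply: (cvge_to_le cvgT); exact: nearW.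
Qed.
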